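(* Let $p(n)$ be the probability that there are no survivors in the group Russian roulette problem with $n$ people. Then $\lim_{n\to\infty}p(n)$ does not exist. Moreover, $$0.4702<\liminf_{n\to\infty}p(n)<0.4714\qquad\text{and}\qquad 0.5227<\limsup_{n\to\infty}p(n)<0.5237.$$
   Context: Group Russian roulette with $n$ people: in each round, as long as at least two people are alive, every living person independently selects, uniformly at random, one of the other living people, and all shoot simultaneously; every person who is selected by at least one other person is killed. The survivors play further rounds in the same way (with fresh independent choices) until either one or zero survivors are left. $p(n)$ is the probability that in the end no survivor is left, with $p(0)=1$ and $p(1)=0$. Equivalently, if $Y(n)$ is the number of survivors of one round starting with $n\ge 2$ people, then $p(n)=\mathbb{E}[p(Y(n))]$ for $n\ge 2$. *)

(* Defs.v *)
From HB Require Import structures.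
From mathcomp Require Import all_boot all_order all_algebra.
From mathcomp Require Import all_classical all_reals all_analysis.

Set Implicit Arguments.
Unset Strict Implicit.
Unset Printing Implicit Defensive.

Import Order.TTheory GRing.Theory Num.Theory.
Import numFieldNormedType.Exports.

Local Open Scope ring_scope.

(* [f i] is the person selected by [i].  Dead people are pinned to themselves,
   so that each joint selection of the people in [A] is counted exactly once. *)
Definition selections (n : nat) (A : {set 'I_n}) : {set {ffun 'I_n -> 'I_n}} :=
  [set f : {ffun 'I_n -> 'I_n} |
    [forall i, if i \in A then f i \in A :\ i else f i == i]].

Definition survivors (n : nat) (A : {set 'I_n}) (f : {ffun 'I_n -> 'I_n}) :
    {set 'I_n} :=
  A :\: f @: A.

(* Probability that the set [A] of living people becomes [B] in one round.
   Independent uniform selections by the members of [A] amount to a uniformly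
   distributed element of the product set [selections A].  Once at most one
   person is alive, nothing changes any more. *)
Definition round_prob (R : realType) (n : nat) (A B : {set 'I_n}) : R :=
  if (2 <= #|A|)%N then
    #|[set f in selections A | survivors A f == B]|%:R / #|selections A|%:R
  else (A == B)%:R.

(* Probability that the set of living people after [t] rounds is [B]; the
   rounds use fresh independent selections, so this is a Markov chain. *)
Fixpoint alive_prob (R : realType) (n t : nat) (B : {set 'I_n}) : R :=
  if t is s.+1 then
    \sum_(A : {set 'I_n}) alive_prob R s A * round_prob R A B
  else (B == [set: 'I_n])%:R.

(* The events "nobody is alive after [t] rounds" increase with [t]; the
   probability of their union is the limit of their probabilities. *)
Definition no_survivor_prob (R : realType) (n : nat) : R :=
  limn (fun t => alive_prob R t (finset.set0 : {set 'I_n})).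

(* Main.v *)
Require Import Defs.
From Stdlib Require Import BinNat BinPos Pnat Nnat.
From HB Require Import structures.
From mathcomp Require Import all_boot all_order all_algebra.
From mathcomp Require Import all_classical all_reals all_analysis.
From mathcomp Require Import fingroup perm.
From mathcomp Require Import zify ring lra.

Set Implicit Arguments.
Unset Strict Implicit.
Unset Printing Implicit Defensive.

Import Order.TTheory GRing.Theory Num.Theory.
Import numFieldNormedType.Exports.

Local Open Scope ring_scope.

(** Write [Y] for the number of survivors of one round among [n] people and
    [p n] for the probability that nobody survives in the end, so that
    [p n = E (p Y)] for [n >= 2]; the same recursion holds for [1 - p].

    The proof rests on the test functions [phi_a n = n / a + a / (n + 1) - 2],
    for real [a > 0].  For [n + 1] near [a], [phi_a n] is, up to the small
    term [1 / a], about the square of the distance between [n + 1] and [a] on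
    a logarithmic scale, and it is not positive when [n + 1] is within [1] of
    [a].  A round divides the number of people by about [e], and the two
    inequalities [E Y <= n / e] and [E (1 / (Y + 1)) <= e / (n + 1)] (lemmas
    [round_law_mean_e] and [inverse_moment_e]) say exactly that
    [E (phi_a Y) <= phi_(e a) n].  Hence if [f] is [p] or [1 - p], an
    inequality [f <= M + K phi_a], valid at all [n], entails the same
    inequality with [e a] in place of [a], at least if [a] is large enough for
    the few smallest [n] to be trivial ([dominated_step]): the random
    fluctuations of all later rounds cost nothing but the term [K / a] that
    the first inequality has to pay.  Iterating, and evaluating at [n + 1]
    close to [e^k a]:
    - if the inequality holds for one [a], then [f n <= M] for infinitely many
      [n] ([dominated_infinitely]);
    - if it holds for all [a] in a window [[A, e A]], then [f n <= M] for all
      [n >= A - 1] ([dominated_window]).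

    With [f = p] and [f = 1 - p] this gives the four bounds on the upper and
    the lower limit, and these separate the two limits.

    What remains is to establish the initial inequalities, which is a finite
    computation with the values of [p] up to about [1300], because [K phi_a]
    exceeds all probabilities far away from [a].  Removing a survivor from a
    round of [n + 1] people yields a recursion with nonnegative coefficients
    for the law of [Y] ([round_law_rec]); evaluated in floating point numbers
    that are rounded down, starting from the derangements, which leave no
    survivor, it gives lower bounds for the law, hence for both [p n] and
    [1 - p n].  A first, crude window then provides a bound for all larger
    [n], with which flatter test functions (smaller [K]) become admissible; a
    few such phases reach the required precision. *)

(** * Factorial moments of the number of survivors *)

(** For every member of [A] the admissible targets can be listed separately:
    it must avoid [S] and itself. *)
Lemma card_selections_sparing (n : nat) (A S : {set 'I_n}) : S \subset A ->
  #|[set f in selections A | S \subset survivors A f]| =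
  ((#|A| - #|S|) ^ #|S| * (#|A| - #|S|).-1 ^ (#|A| - #|S|))%N.
Proof.
move=> SA.
pose F (i : 'I_n) : {set 'I_n} := if i \in A then A :\: S :\ i else [set i].
have eqF : [set f in selections A | S \subset survivors A f] =i family F.
  move=> f; rewrite !inE; apply/andP/familyP => [[/forallP sel surv] i|Ff].
    rewrite /F; case: ifP (sel i) => iA; last by move=> /eqP ->; rewrite inE.
    rewrite !inE => /andP[-> fA]; rewrite fA andbT /=.
    apply/negP => /(fintype.subsetP surv); rewrite !inE => /andP[/negP[]].
    by rewrite imset_f.
  split; [apply/forallP => i|apply/fintype.subsetP => i iS].
    move: (Ff i); rewrite /F; case: ifP => iA; last by rewrite inE.
    by rewrite !inE => /andP[-> /andP[]].
  rewrite !inE (fintype.subsetP SA) // andbT; apply/imsetP => -[j jA ij].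
  by move: (Ff j); rewrite /F jA !inE -ij iS andbF.
rewrite (eq_card eqF) card_family foldrE big_map big_enum /= (bigID (mem A)) /=.
rewrite [X in (_ * X)%N]big1 ?muln1; last first.
  by move=> i /negbTE iA; rewrite /F iA cards1.
rewrite (bigID (mem S)) /=; congr (_ * _)%N.
  rewrite (eq_bigl (mem S)); last first.
    by move=> i /=; case: (boolP (i \in S)) => [/(fintype.subsetP SA)->|]; rewrite ?andbF.
  rewrite (eq_bigr (fun=> (#|A| - #|S|)%N)) ?prod_nat_const // => i iS.
  rewrite /F (fintype.subsetP SA) //.
  have := cardsD1 i (A :\: S); rewrite !inE (iS : i \in S) /= add0n => <-.
  by rewrite cardsD (finset.setIidPr SA).
rewrite (eq_bigl (mem (A :\: S))); last by move=> i /=; rewrite !inE andbC.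
rewrite (eq_bigr (fun=> (#|A| - #|S|).-1)); last first.
  move=> i; rewrite !inE => /andP[iS iA]; rewrite /F iA.
  have := cardsD1 i (A :\: S); rewrite !inE iS iA /= cardsD (finset.setIidPr SA) => ->.
  by rewrite add1n.
by rewrite prod_nat_const cardsD (finset.setIidPr SA).
Qed.

Lemma card_selections (n : nat) (A : {set 'I_n}) :
  #|selections A| = (#|A|.-1 ^ #|A|)%N.
Proof.
have := card_selections_sparing (finset.sub0set A).
rewrite cards0 expn0 mul1n subn0 => <-; apply: eq_card => f.
by rewrite !inE finset.sub0set andbT.
Qed.

Definition survivor_count (n : nat) (A : {set 'I_n}) (k : nat) : nat :=
  #|[set f in selections A | #|survivors A f| == k]|.

(** The number of pairs of a [j]-subset of [m] people and a selection that
    spares it. *)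
Definition sparing_count (m j : nat) : nat :=
  ('C(m, j) * ((m - j) ^ j * (m - j).-1 ^ (m - j)))%N.

Lemma card_survivors (n : nat) (A : {set 'I_n}) f :
  (#|survivors A f| <= #|A|)%N.
Proof. exact/subset_leq_card/finset.subsetDl. Qed.

Lemma sum_survivors (V : nmodType) (n : nat) (A : {set 'I_n}) (g : nat -> V) :
  \sum_(f in selections A) g #|survivors A f| =
  \sum_(k < #|A|.+1) g k *+ survivor_count A k.
Proof.
rewrite (partition_big (fun f => inord #|survivors A f| : 'I_#|A|.+1) predT) //=.
apply: eq_bigr => k _; rewrite /survivor_count -sumr_const.
rewrite [RHS](eq_bigl (fun f => (f \in selections A) && (#|survivors A f| == k))); last first.
  by move=> f; rewrite inE.
apply: eq_big => [f|f /andP[_ /eqP <-]].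
  by rewrite -val_eqE /= inordK // ltnS card_survivors.
by rewrite inordK // ltnS card_survivors.
Qed.

(** Double counting of the pairs formed by a selection and a set of [j]
    of its survivors. *)
Lemma survivor_moment (n : nat) (A : {set 'I_n}) (j : nat) :
  (\sum_(k < #|A|.+1) survivor_count A k * 'C(k, j))%N = sparing_count #|A| j.
Proof.
have eqC k : ('C(k, j) : nat) *+ survivor_count A k =
    (survivor_count A k * 'C(k, j))%N by rewrite -mulr_natr natn mulnC.
have := sum_survivors A (fun k => 'C(k, j)).
under [in RHS]eq_bigr do rewrite eqC.
move=> <-; rewrite /sparing_count.
transitivity (\sum_(f in selections A)
    \sum_(S in [set S : {set 'I_n} | S \subset A & #|S| == j]) (S \subset survivors A f : nat))%N.
  apply: eq_bigr => f _; rewrite -cards_draws -sum1dep_card.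
  rewrite [RHS](bigID (fun S : {set 'I_n} => S \subset survivors A f)) /=.
  rewrite [X in (_ = _ + X)%N]big1 ?addn0 => [|S /andP[_ /negbTE->]//].
  apply: eq_big => [S|S /andP[-> _]//]; rewrite inE.
  rewrite [in RHS]andbC andbA; congr (_ && _).
  by case: (boolP (S \subset _)) => //= /fintype.subset_trans ->; rewrite ?finset.subsetDl.
rewrite exchange_big /= -cards_draws -sum_nat_const.
apply: eq_bigr => S; rewrite inE => /andP[SA /eqP <-].
rewrite -card_selections_sparing // -sum1dep_card big_mkcond [RHS]big_mkcond /=.
apply: eq_bigr => f _; rewrite ?inE.
by set b := [forall _, _]; case: b; case: (S \subset _).
Qed.

(** The binomial matrix is triangular with unit diagonal. *)
Lemma factorial_moments_inj (m : nat) (a b : nat -> nat) :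
  (forall j, (\sum_(k < m.+1) a k * 'C(k, j) = \sum_(k < m.+1) b k * 'C(k, j))%N) ->
  forall k, (k <= m)%N -> a k = b k.
Proof.
elim: m => [|m IHm] eqab k km.
  move: km (eqab 0%N); rewrite leqn0 => /eqP ->.
  by rewrite !big_ord_recr !big_ord0 /= bin0 !muln1.
have top : a m.+1 = b m.+1.
  have := eqab m.+1; rewrite !(big_ord_recr m.+1) /= binn !muln1.
  by rewrite !big1 // => i _; rewrite bin_small ?muln0.
move: km; rewrite leq_eqVlt => /predU1P[->//|]; apply: IHm => j.
have := eqab j; rewrite !(big_ord_recr m.+1) /= top => /eqP.
by rewrite eqn_add2r => /eqP.
Qed.

Definition round_count (n k : nat) : nat := survivor_count [set: 'I_n] k.

Lemma round_moment (n j : nat) :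
  (\sum_(k < n.+1) round_count n k * 'C(k, j))%N = sparing_count n j.
Proof. by have := survivor_moment [set: 'I_n] j; rewrite cardsT card_ord. Qed.

Lemma round_count_eq0 n k : (n < k)%N -> round_count n k = 0%N.
Proof.
move=> nk; apply: eq_card0 => f; rewrite !inE; apply/negP => /andP[_ /eqP eqS].
by have := card_survivors [set: 'I_n] f; rewrite eqS cardsT card_ord leqNgt nk.
Qed.

(** People are exchangeable: only the number of people alive matters, since
    it determines the factorial moments. *)
Lemma survivor_countE (n : nat) (A : {set 'I_n}) (k : nat) :
  (k <= #|A|)%N -> survivor_count A k = round_count #|A| k.
Proof.
move=> kA; apply: (@factorial_moments_inj #|A|) => // j.
by rewrite survivor_moment round_moment.
Qed.

Lemma sum_round_count (n : nat) : (\sum_(k < n.+1) round_count n k)%N = (n.-1 ^ n)%N.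
Proof.
have := round_moment n 0; rewrite /sparing_count bin0 mul1n subn0 expn0 mul1n => <-.
by apply: eq_bigr => k _; rewrite bin0 muln1.
Qed.

Lemma mul_binl_ordS (k j : nat) : (k.+1 * 'C(k, j) = j.+1 * 'C(k.+1, j.+1))%N.
Proof. exact: (mul_bin_diag k.+1 j). Qed.

Lemma mul_binS_lower (n k j : nat) : (k <= n)%N ->
  ((n - k) * 'C(k, j) + j.+1 * 'C(k, j.+1) = (n - j) * 'C(k, j))%N.
Proof.
move=> kn; rewrite mul_bin_left.
have [jk|kj] := leqP j k; last by rewrite bin_small // !muln0.
by rewrite -mulnDl; congr (_ * _)%N; lia.
Qed.

Lemma sparing_count_rec (n j : nat) :
  (j.+1 * sparing_count n.+1 j.+1 = n.+1 * ((n - j) * sparing_count n j))%N.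
Proof.
rewrite /sparing_count subSS mulnA -(mul_bin_diag n.+1) -!mulnA; congr (_ * _)%N.
by rewrite [RHS]mulnCA expnS !mulnA.
Qed.

(** Remove one of the survivors of a round of [n.+1] people.  The person whom
    that survivor selected is either among the [n - k] people still hit by
    others, or becomes one of the [k.+1] survivors of the remaining round. On
    factorial moments this is [sparing_count_rec]. *)
Lemma round_count_rec (n k : nat) : (k <= n)%N ->
  (k.+1 * round_count n.+1 k.+1 =
   n.+1 * ((n - k) * round_count n k + k.+1 * round_count n k.+1))%N.
Proof.
move=> kn.
pose a k := (k.+1 * round_count n.+1 k.+1)%N.
pose b k := (n.+1 * ((n - k) * round_count n k + k.+1 * round_count n k.+1))%N.
apply: (@factorial_moments_inj n a b) => // j.
have shiftE m (c : nat -> nat) : (\sum_(k < m.+1) (k.+1 * c k.+1) * 'C(k, j) =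
    j.+1 * \sum_(k < m.+2) c k * 'C(k, j.+1))%N.
  rewrite [in RHS]big_ord_recl bin0n muln0 add0n big_distrr /=.
  by apply: eq_bigr => i _; rewrite mulnAC mul_binl_ordS -mulnA (mulnC 'C(_, _)).
rewrite /a shiftE round_moment sparing_count_rec.
under eq_bigr do rewrite /b -mulnA mulnDl.
rewrite -big_distrr /= big_split /= shiftE; congr (_ * _)%N.
rewrite (big_ord_recr n.+1) /=.
rewrite [round_count n n.+1]round_count_eq0 //.
rewrite mul0n addn0 big_distrr /= -big_split /= -round_moment big_distrr /=.
apply: eq_bigr => i _; have := @mul_binS_lower n i j (ltn_ord i).
by move=> /(congr1 (muln (round_count n i))); lia.
Qed.

Definition fixed_points (n : nat) (s : {perm 'I_n}) : {set 'I_n} := [set i | s i == i].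

(** A permutation that fixes [S] pointwise is a permutation of its complement. *)
Lemma fixed_point_moment (n j : nat) :
  (\sum_(s : {perm 'I_n}) 'C(#|fixed_points s|, j))%N = ('C(n, j) * (n - j)`!)%N.
Proof.
transitivity (\sum_(s : {perm 'I_n}) \sum_(S in [set S : {set 'I_n} | #|S| == j])
   (S \subset fixed_points s : nat))%N.
  apply: eq_bigr => s _; rewrite -cards_draws -sum1dep_card.
  rewrite [RHS](bigID (fun S : {set 'I_n} => S \subset fixed_points s)) /=.
  rewrite [X in (_ = _ + X)%N]big1 ?addn0 => [|S /andP[_ /negbTE->]//].
  by apply: eq_big => [S|S /andP[-> _]//]; rewrite inE andbC.
rewrite exchange_big /=.
have -> : 'C(n, j) = #|[set S : {set 'I_n} | S \subset [set: 'I_n] & #|S| == j]|.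
  by rewrite cards_draws cardsT card_ord.
rewrite -sum_nat_const.
apply: eq_big => [S|S]; rewrite !inE ?finset.subsetT // => /eqP <-.
have -> : (n - #|S|)%N = #|~: S| by have := cardsC S; rewrite card_ord; lia.
rewrite -card_perm -sum1_card [RHS]big_mkcond; apply: eq_bigr => s _.
rewrite unfold_in /perm_on.
suff -> : S \subset fixed_points s = ([pred x | s x != x] \subset ~: S) by case: ifP.
apply/fintype.subsetP/fintype.subsetP => sub x; rewrite !inE.
  by apply: contraNN => /sub; rewrite inE.
by move=> xS; apply/eqP/eqP; apply: contraTT xS => /(sub x); rewrite inE.
Qed.

(** Derangements kill everybody at once; they are counted by inclusion and
    exclusion over the sets of fixed points. *)
Lemma round_count0_ge (R : numFieldType) (n : nat) :
  \sum_(j < n.+1) (-1) ^+ j / j`!%:R <= (round_count n 0)%:R / n`!%:R :> R.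
Proof.
pose D := [set s : {perm 'I_n} | fixed_points s == finset.set0].
have factR_neq0 m : m`!%:R != 0 :> R by rewrite pnatr_eq0 -lt0n fact_gt0.
have cardD : #|D|%:R = \sum_(j < n.+1) (-1) ^+ j * ('C(n, j) * (n - j)`!)%:R :> R.
  under [RHS]eq_bigr do rewrite -fixed_point_moment natr_sum big_distrr /=.
  rewrite exchange_big /= -sum1_card natr_sum big_mkcond /=; apply: eq_bigr => s _.
  have fixn : (#|fixed_points s| <= n)%N by have := max_card (fixed_points s); rewrite card_ord.
  transitivity ((1 - 1 : R) ^+ #|fixed_points s|).
    by rewrite inE -cards_eq0 subrr expr0n; case: (_ == _).
  set m := #|_|; rewrite exprBn.
  pose F j : R := ((-1) ^+ j * 1 ^+ (m - j) * 1 ^+ j) *+ 'C(m, j).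
  rewrite (big_ord_widen n.+1 F) ?ltnS // /F.
  rewrite big_mkcond; apply: eq_bigr => j _; case: ltnP => jf.
    by rewrite !expr1n !mulr1 mulr_natr.
  by rewrite bin_small ?mulr0.
have -> : \sum_(j < n.+1) (-1) ^+ j / j`!%:R = #|D|%:R / n`!%:R :> R.
  rewrite cardD mulr_suml; apply: eq_bigr => -[j jn] _ /=.
  rewrite -mulrA; congr (_ * _).
  have := bin_fact (jn : j <= n)%N; rewrite mulnCA => <-.
  set c := ('C(n, j) * (n - j)`!)%N; rewrite (natrM _ j`!) invfM mulrCA divff ?mulr1 //.
  by rewrite pnatr_eq0 -lt0n muln_gt0 bin_gt0 (jn : j <= n)%N fact_gt0.
rewrite ler_pM2r ?invr_gt0 ?ltr0n ?fact_gt0 // ler_nat.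
have inj : injective (fun s : {perm 'I_n} => [ffun i => s i]).
  by move=> s t /ffunP st; apply/permP => i; have := st i; rewrite !ffunE.
rewrite -(card_imset _ inj); apply/subset_leq_card/fintype.subsetP => _ /imsetP[s sD ->].
move: sD; rewrite !inE => /eqP/setP sD.
apply/andP; split.
  apply/forallP => i; rewrite !inE ffunE andbT.
  by have := sD i; rewrite !inE => ->.
rewrite cards_eq0; apply/eqP/setP => i; rewrite !inE andbT; apply/negbTE.
by rewrite negbK; apply/imsetP; exists ((s^-1)%g i); rewrite ?inE // ffunE permKV.
Qed.

(** * From sets of living people to their number *)

Definition round_law (R : realType) (n k : nat) : R :=
  (round_count n k)%:R / (n.-1 ^ n)%:R.

Section RoundLaw.
Variable R : realType.
Local Notation Q := (@round_law R).

Lemma round_law_ge0 n k : 0 <= Q n k.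
Proof. by rewrite divr_ge0. Qed.

Lemma selections_neq0 n : (2 <= n)%N -> (n.-1 ^ n)%:R != 0 :> R.
Proof. by case: n => [|[|n]] //= _; rewrite pnatr_eq0 expn_eq0. Qed.

Lemma sum_round_law n : (2 <= n)%N -> \sum_(k < n.+1) Q n k = 1.
Proof.
move=> n2; rewrite -mulr_suml -natr_sum sum_round_count divff //.
exact: selections_neq0.
Qed.

Lemma round_law_mean n : (2 <= n)%N ->
  \sum_(k < n.+1) Q n k * k%:R = n%:R * (n.-2%:R / n.-1%:R) ^+ n.-1.
Proof.
move=> n2; have := round_moment n 1.
under eq_bigr do rewrite bin1.
move=> /(congr1 (fun i => i%:R / (n.-1 ^ n)%:R : R)).
rewrite natr_sum mulr_suml => eqM.
rewrite (eq_bigr (fun k : 'I_n.+1 => (round_count n k * k)%:R / (n.-1 ^ n)%:R : R)); last first.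
  by move=> k _; rewrite /round_law natrM mulrAC.
rewrite eqM /sparing_count bin1 expn1 subn1 !natrM !natrX expr_div_n -mulrA.
congr (_ * _); case: n n2 {eqM} => [|[|n]]//= _.
by rewrite exprS invfM mulrACA divff ?mul1r // pnatr_eq0.
Qed.

Lemma round_law_rec n k : (2 <= n)%N -> (k <= n)%N ->
  k.+1%:R * Q n.+1 k.+1 =
  n.+1%:R * (n.-1%:R ^+ n / n%:R ^+ n.+1) *
    ((n - k)%:R * Q n k + k.+1%:R * Q n k.+1).
Proof.
move=> n2 kn; have /(congr1 (fun i => i%:R : R)) := round_count_rec kn.
rewrite natrM natrM natrD !natrM => eqr.
rewrite /round_law [LHS]mulrA eqr /= !natrX.
have: n.-1%:R ^+ n != 0 :> R by rewrite -natrX selections_neq0.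
have: n%:R ^+ n.+1 != 0 :> R by rewrite -natrX (selections_neq0 (ltnW _)).
move: (n%:R ^+ n.+1) (n.-1%:R ^+ n) (n - k)%:R k.+1%:R n.+1%:R => d q x y z d0 q0.
by field; rewrite d0 q0.
Qed.

Lemma sum_round_prob n (A : {set 'I_n}) (g : nat -> R) : (2 <= #|A|)%N ->
  \sum_(B : {set 'I_n}) round_prob R A B * g #|B| =
  \sum_(k < #|A|.+1) Q #|A| k * g k.
Proof.
move=> A2; rewrite /round_prob A2 card_selections.
transitivity ((\sum_(f in selections A) g #|survivors A f|) / (#|A|.-1 ^ #|A|)%:R).
  rewrite mulr_suml (partition_big (survivors A) predT) //=.
  apply: eq_bigr => B _; rewrite mulrAC -sum1dep_card natr_sum !mulr_suml.
  by apply: eq_big => // f /andP[_ /eqP ->]; rewrite mul1r.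
rewrite sum_survivors mulr_suml; apply: eq_bigr => k _.
have kA : (k <= #|A|)%N by rewrite -ltnS.
by rewrite survivor_countE // /round_law -[g k *+ _]mulr_natr -mulrA mulrC.
Qed.

(** Decomposes [t] rounds along the first one, whereas [alive_prob] decomposes
    them along the last one. *)
Fixpoint extinct_by (t n : nat) : R :=
  if t is s.+1 then
    if (2 <= n)%N then \sum_(k < n.+1) Q n k * extinct_by s k else (n == 0)%N%:R
  else (n == 0)%N%:R.

Lemma extinct_by_small t n : (n < 2)%N -> extinct_by t n = (n == 0)%N%:R.
Proof. by case: t => //= t; rewrite ltnNge => /negbTE ->. Qed.

Lemma round_extinct_by n t (A : {set 'I_n}) :
  \sum_(B : {set 'I_n}) round_prob R A B * extinct_by t #|B| = extinct_by t.+1 #|A|.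
Proof.
rewrite /=; case: ifPn => A2; first exact: sum_round_prob.
rewrite (bigD1 A) //= /round_prob (negbTE A2) eqxx mul1r.
rewrite big1 ?addr0 => [|B /negbTE BA]; first by rewrite extinct_by_small // ltnNge.
by rewrite eq_sym BA mul0r.
Qed.

(** Moving rounds from the evolution of the law of the set of living people
    to the function that is averaged over it, one at a time. *)
Lemma alive_extinct n t s :
  \sum_(A : {set 'I_n}) alive_prob R t A * extinct_by s #|A| = extinct_by (t + s) n.
Proof.
elim: t s => [|t IHt] s; rewrite [alive_prob _ _]/=.
  rewrite (bigD1 [set: 'I_n]) //= eqxx mul1r cardsT card_ord.
  by rewrite big1 ?addr0 // => A /negbTE ->; rewrite mul0r.
under eq_bigr do rewrite mulr_suml.
rewrite exchange_big addSnnS -IHt.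
apply: eq_bigr => A _; rewrite -round_extinct_by mulr_sumr.
by apply: eq_bigr => B _; rewrite mulrA.
Qed.

Lemma alive_prob0 n t : alive_prob R t (finset.set0 : {set 'I_n}) = extinct_by t n.
Proof.
have := alive_extinct n t 0; rewrite addn0 => <-.
rewrite (bigD1 (finset.set0 : {set 'I_n})) //= cards0 eqxx mulr1.
by rewrite big1 ?addr0 // => A; rewrite cards_eq0 => /negbTE ->; rewrite mulr0.
Qed.

Lemma extinct_by_bounds t n : 0 <= extinct_by t n <= 1.
Proof.
elim: t n => [|t IHt] n /=; first by case: (n == 0)%N; rewrite ?lexx ?ler01.
case: ifPn => n2; last by case: (n == 0)%N; rewrite ?lexx ?ler01.
apply/andP; split.
  by apply: sumr_ge0 => k _; rewrite mulr_ge0 ?round_law_ge0//; case/andP: (IHt k).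
rewrite -(sum_round_law n2); apply: ler_sum => k _.
by rewrite ler_piMr ?round_law_ge0//; case/andP: (IHt k).
Qed.

Lemma extinct_byS t n : extinct_by t n <= extinct_by t.+1 n.
Proof.
elim: t n => [|t IHt] n.
  have /andP[] := extinct_by_bounds 1 n; case: n => [|n] //=.
rewrite /= -/extinct_by; case: ifP => // n2.
by apply: ler_sum => k _; rewrite ler_wpM2l ?round_law_ge0.
Qed.

Lemma no_survivor_cvg n : (extinct_by t n @[t --> \oo] --> no_survivor_prob R n)%classic.
Proof.
rewrite /no_survivor_prob; under [X in limn X]funext do rewrite alive_prob0.
apply: nondecreasing_is_cvgn.
  by apply/nondecreasing_seqP => t; exact: extinct_byS.
by exists 1 => _ [t _ <-]; case/andP: (extinct_by_bounds t n).
Qed.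

Lemma no_survivor_bounds n : 0 <= no_survivor_prob R n <= 1.
Proof.
have cvp := @no_survivor_cvg n; rewrite -(cvg_lim _ cvp) //.
have cp : cvgn (extinct_by ^~ n) by apply/cvg_ex; eexists; exact: cvp.
by apply/andP; split; [apply: limr_ge|apply: limr_le] => //; apply: nearW => t;
  case/andP: (extinct_by_bounds t n).
Qed.

Lemma no_survivor_small n : (n < 2)%N -> no_survivor_prob R n = (n == 0)%N%:R.
Proof.
move=> n2; rewrite -(cvg_lim _ (@no_survivor_cvg n)) //.
under [X in limn X]funext do rewrite extinct_by_small //.
exact: lim_cst.
Qed.

Lemma no_survivor_rec n : (2 <= n)%N ->
  no_survivor_prob R n = \sum_(k < n.+1) Q n k * no_survivor_prob R k.
Proof.
move=> n2.
have cvS : (extinct_by t.+1 n @[t --> \oo] --> no_survivor_prob R n)%classic.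
  by have := @no_survivor_cvg n; rewrite -cvg_shiftS.
apply: cvg_unique cvS _ => //.
rewrite /= n2; apply: (cvg_big (U := R)) => [|k _]; first exact: add_continuous.
by apply: cvgM; [exact: cvg_cst|exact: no_survivor_cvg].
Qed.

Lemma round_law2 : Q 2 0 = 1 /\ Q 2 1 = 0 /\ Q 2 2 = 0.
Proof.
have : (\sum_(k < 2) round_count 1 k)%N = 0%N by rewrite sum_round_count.
rewrite !big_ord_recr big_ord0 /= add0n => /eqP; rewrite addn_eq0 => /andP[/eqP c10 /eqP c11].
have c21 : round_count 2 1 = 0%N.
  by have := @round_count_rec 1 0 isT; rewrite c10 c11 !mul1n => ->.
have c22 : round_count 2 2 = 0%N.
  have /eqP := @round_count_rec 1 1 isT; rewrite c11 (@round_count_eq0 1 2) //.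
  by rewrite muln0 muln_eq0 => /eqP.
have := @sum_round_law 2 isT.
rewrite !big_ord_recr big_ord0 /= add0r /round_law c21 c22 mul0r !addr0.
by split.
Qed.

Lemma no_survivor2 : no_survivor_prob R 2 = 1.
Proof.
rewrite no_survivor_rec // !big_ord_recr big_ord0 /= add0r.
have [-> [-> ->]] := round_law2.
by rewrite !mul0r !addr0 mul1r no_survivor_small.
Qed.

End RoundLaw.

(** * Test functions *)

Section ExpBounds.
Variable R : realType.
Implicit Types x : R.

Lemma expR_ge1Dx2 x : 0 <= x -> 1 + x + x ^+ 2 / 2 <= expR x.
Proof.
move=> x0; have nd : nondecreasing_seq (series (exp_coeff x)).
  by apply/nondecreasing_seqP => n; rewrite seriesSr lerDl /exp_coeff /= divr_ge0 // exprn_ge0.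
have := nondecreasing_cvgn_le nd (@is_cvg_series_exp_coeff R x) 3.
by rewrite /series /= !big_nat_recr //= big_nil /exp_coeff /= expr0 expr1 !divr1 add0r.
Qed.

Lemma expR_le_inv x : 0 <= x < 1 -> expR x <= (1 - x)^-1.
Proof.
move=> /andP[x0 x1]; rewrite -[x in expR x]opprK expRN lef_pV2 ?posrE ?expR_gt0 ?subr_gt0 //.
exact: expR_ge1Dx.
Qed.

Lemma e_ge2 : 2 <= expR 1 :> R.
Proof. by have := expR_ge1Dx (1 : R). Qed.

Lemma e_le : expR 1 <= 274 / 100 :> R.
Proof.
have -> : expR 1 = expR (1 / 64) ^+ 64 :> R.
  by rewrite -expRM_natl; congr expR; field.
rewrite (@le_trans _ _ ((64 / 63) ^+ 64)) //.
  rewrite lerXn2r ?nnegrE ?expR_ge0 ?divr_ge0 //.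
  have -> : 64 / 63 = (1 - 1 / 64)^-1 :> R by field.
  by apply: expR_le_inv; apply/andP; split; lra.
rewrite expr_div_n ler_pdivrMr; last exact: exprn_gt0.
rewrite mulrAC ler_pdivlMr; last by rewrite ltr0n.
rewrite -!natrX -!natrM ler_nat.
lia.
Qed.

(** [(1 - 1/m)^m] increases to [1/e]. *)
Lemma pow_pred_le (m : nat) : (0 < m)%N -> (m.-1%:R / m%:R) ^+ m <= (expR 1)^-1 :> R.
Proof.
move=> m0; have mR : 0 < m%:R :> R by rewrite ltr0n.
have -> : m.-1%:R / m%:R = 1 + - m%:R^-1 :> R.
  by rewrite -subn1 natrB // mulrBl divff ?gt_eqF // mul1r.
have -> : (expR 1)^-1 = expR (- m%:R^-1) ^+ m :> R.
  by rewrite -expRN -expRM_natl mulrN divff ?gt_eqF.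
rewrite lerXn2r ?nnegrE ?expR_ge0 ?expR_ge1Dx // subr_ge0.
by rewrite invf_le1 // ler1n.
Qed.

(** [y] is chosen so that [(m + 1) y = 1 + 1/(2m)]; the second order term of
    [exp y] makes up for [y < 1/m]. *)
Lemma pow_succ_le (m : nat) : (0 < m)%N ->
  (m.+1%:R / m%:R) ^+ m.+1 <= expR 1 * ((2 * m%:R) / (2 * m%:R - 1)) :> R.
Proof.
move=> m0; have : 1 <= m%:R :> R by rewrite ler1n.
rewrite -natr1; set x := m%:R => x1.
pose y : R := (2 * x + 1) / (2 * x * (x + 1)).
have xn0 : x != 0 by apply/eqP; lra.
have x1n0 : x + 1 != 0 by apply/eqP; lra.
have y0 : 0 <= y by apply: divr_ge0; nra.
have le_y : (x + 1) / x <= expR y.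
  apply: le_trans (expR_ge1Dx2 y0); rewrite -subr_ge0.
  have -> : 1 + y + y ^+ 2 / 2 - (x + 1) / x = (1 / (x * (x + 1))) ^+ 2 / 8.
    by rewrite /y; field; rewrite xn0 x1n0.
  by rewrite divr_ge0 // sqr_ge0.
apply: (@le_trans _ _ (expR y ^+ m.+1)).
  by rewrite lerXn2r ?nnegrE ?expR_ge0 ?divr_ge0 //; lra.
have -> : expR y ^+ m.+1 = expR 1 * expR (1 / (2 * x)) :> R.
  rewrite -expRM_natl -expRD -natr1 -/x; congr expR.
  by rewrite /y; field; rewrite xn0 x1n0.
have half : 0 <= 1 / (2 * x) < 1.
  apply/andP; split; first by apply: divr_ge0; lra.
  by rewrite ltr_pdivrMr; lra.
rewrite ler_wpM2l ?expR_ge0 //; apply: le_trans (expR_le_inv half) _.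
suff -> : (1 - 1 / (2 * x))^-1 = 2 * x / (2 * x - 1) by [].
by field; do ?[apply/andP; split]; apply/eqP; lra.
Qed.

End ExpBounds.

Section InverseMoment.
Variable R : realType.
Local Notation Q := (@round_law R).
Local Notation e := (expR 1 : R).

(** The rate in [round_law_rec]; it tends to [1/e]. *)
Definition growth (n : nat) : R := n.+1%:R * (n.-1%:R ^+ n / n%:R ^+ n.+1).

Lemma growth_gt0 n : (2 <= n)%N -> 0 < growth n.
Proof.
by case: n => [|[|n]] // _; rewrite mulr_gt0 ?divr_gt0 ?exprn_gt0 ?ltr0n.
Qed.

(** The factor on the right is [1 - 1/(2n)] up to second order; this gap of
    order [1/n] absorbs the probability of an immediate extinction in
    [inverse_moment_e]. *)
Lemma growth_inv_le n : (2 <= n)%N ->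
  (growth n)^-1 <= e * (2 * n.-1%:R * n%:R / ((n%:R + 1) * (2 * n%:R - 3))).
Proof.
case: n => [|n] // n2; have := pow_succ_le R (n2 : 0 < n)%N; rewrite /growth /=.
have n0 : 1 <= n%:R :> R by rewrite ler1n.
set P := (_ / _) ^+ _ => leP.
have -> : (n.+2%:R * (n%:R ^+ n.+1 / n.+1%:R ^+ n.+2))^-1 = P * (n.+1%:R / n.+2%:R) :> R.
  rewrite /P expr_div_n [n.+1%:R ^+ n.+2]exprS.
  have : n.+2%:R != 0 :> R by rewrite pnatr_eq0.
  have : n.+1%:R != 0 :> R by rewrite pnatr_eq0.
  have : n.+1%:R ^+ n.+1 != 0 :> R by rewrite expf_neq0 // pnatr_eq0.
  have : n%:R ^+ n.+1 != 0 :> R by rewrite expf_neq0 // pnatr_eq0 -lt0n.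
  move: n.+2%:R n.+1%:R (n.+1%:R ^+ n.+1) (n%:R ^+ n.+1) => a b c d d0 c0 b0 a0.
  by field; rewrite a0 b0 c0 d0.
apply: (le_trans (ler_wpM2r _ leP)); first by rewrite divr_ge0.
rewrite -[leLHS]mulrA ler_wpM2l ?expR_ge0 //.
rewrite -[n.+2%:R]natr1 -![n.+1%:R]natr1; set x := n%:R : R.
suff -> : 2 * x / (2 * x - 1) * ((x + 1) / (x + 1 + 1)) =
  2 * x * (x + 1) / ((x + 1 + 1) * (2 * (x + 1) - 3)) by [].
by field; do ?[apply/andP; split]; apply/eqP; rewrite /x; lra.
Qed.

Lemma growth_inv_le_e n : (3 <= n)%N -> (growth n)^-1 <= e.
Proof.
move=> n3; apply: le_trans (growth_inv_le (ltnW n3)) _.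
rewrite ger_pMr ?expR_gt0 //.
have : 3 <= n%:R :> R by rewrite ler_nat.
rewrite -subn1 natrB ?(ltnW (ltnW n3)) // => x3.
by rewrite ler_pdivrMr; nra.
Qed.

(** Comparing total masses in the recursion turns it into an inverse moment. *)
Lemma inverse_moment_le n : (2 <= n)%N ->
  n.+1%:R * (\sum_(k < n.+1) Q n k / k.+1%:R) <= (growth n)^-1 + Q n 0.
Proof.
move=> n2; have g0 := growth_gt0 n2.
have total : \sum_(k < n.+1) Q n.+1 k.+1 <= 1.
  rewrite -(sum_round_law R (ltnW (n2 : (2 < n.+1)%N))) [leRHS]big_ord_recl.
  by rewrite lerDr round_law_ge0.
have rest : 1 - Q n 0 <= \sum_(k < n.+1) Q n k.+1.
  rewrite -(sum_round_law R n2) big_ord_recl addrC addKr [leRHS]big_ord_recr /=.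
  by rewrite lerDl round_law_ge0.
suff : growth n * (n.+1%:R * (\sum_(k < n.+1) Q n k / k.+1%:R) - Q n 0) <= 1.
  by rewrite mulrC -ler_pdivlMr // mul1r lerBlDr.
apply: le_trans total.
rewrite [leRHS](eq_bigr (fun k : 'I_n.+1 =>
    growth n * ((n.+1%:R * (Q n k / k.+1%:R) - Q n k) + Q n k.+1))); last first.
  move=> k _; have kn : (k <= n)%N by rewrite -ltnS.
  have k0 : k.+1%:R != 0 :> R by rewrite pnatr_eq0.
  apply: (mulfI k0); rewrite round_law_rec // -/(growth n) -subSS natrB ?ltnS //.
  by move: k.+1%:R n.+1%:R k0 => K N K0; field; rewrite K0.
rewrite -mulr_sumr ler_wpM2l ?(ltW g0) // big_split /= sumrB -mulr_sumr.
by rewrite (sum_round_law R n2); move: rest; lra.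
Qed.

(** By the recursion, one survivor more gains a factor of order [n]; two of them
    turn the trivial bound [1] for a probability into one of order [n ^ (- 2)]. *)
Lemma round_law0_le n : (3 <= n)%N -> Q n 0 <= 2 * e ^+ 2 / n%:R ^+ 2.
Proof.
move=> n3; have n2 := ltnW n3.
have nR : 0 < n%:R :> R by rewrite ltr0n; case: n n3 n2.
have Q1 : n%:R * Q n 0 <= e * Q n.+1 1.
  have := @round_law_rec R n 0 n2 isT; rewrite !mul1r subn0 -/(growth n) => eqQ.
  apply: (@le_trans _ _ ((growth n)^-1 * Q n.+1 1)); last first.
    by rewrite ler_wpM2r ?round_law_ge0 ?growth_inv_le_e.
  rewrite eqQ mulKf ?gt_eqF ?growth_gt0 //.
  by rewrite lerDl round_law_ge0.
have n3' : (3 <= n.+1)%N := n2; have n2' := ltnW n3'.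
have Q2 : n%:R * Q n.+1 1 <= e * 2.
  have := @round_law_rec R n.+1 1 n2' isT; rewrite -/(growth n.+1) subn1 /= => eqQ.
  apply: (@le_trans _ _ ((growth n.+1)^-1 * (2 * Q n.+2 2))).
    rewrite eqQ mulKf ?gt_eqF ?growth_gt0 //.
    by rewrite lerDl mulr_ge0 // round_law_ge0.
  apply: ler_pM; rewrite ?growth_inv_le_e ?mulr_ge0 ?round_law_ge0 //.
    by rewrite invr_ge0 ltW // growth_gt0.
  rewrite ger_pMr // -(sum_round_law R (isT : (2 <= n.+2)%N)) (bigD1 (inord 2)) //=.
  by rewrite inordK // lerDl sumr_ge0 // => k _; exact: round_law_ge0.
rewrite ler_pdivlMr ?exprn_gt0 //.
have e0 := expR_gt0 (1 : R).
have : n%:R * (n%:R * Q n 0) <= n%:R * (e * Q n.+1 1) by rewrite ler_pM2l.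
have : e * (n%:R * Q n.+1 1) <= e * (e * 2) by rewrite ler_pM2l.
by nra.
Qed.

(** From [14] on, the bound [2 e^2 / n^2] for an immediate extinction fits into
    the gap left by [growth_inv_le]. *)
Lemma inverse_moment_e n : (14 <= n)%N ->
  \sum_(k < n.+1) Q n k / k.+1%:R <= e / n.+1%:R.
Proof.
move=> n14.
have n3 : (3 <= n)%N by apply: leq_trans n14.
have n2 := ltnW n3.
rewrite ler_pdivlMr ?ltr0n // mulrC; apply: le_trans (inverse_moment_le n2) _.
apply: le_trans (lerD (growth_inv_le n2) (round_law0_le n3)) _.
have := e_le R; have := e_ge2 R; set E := expR 1 => E2 E3.
have : 14 <= n%:R :> R by rewrite ler_nat.
rewrite -subn1 natrB ?(ltnW n2) //; set x := n%:R => x14.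
have -> : E * (2 * (x - 1) * x / ((x + 1) * (2 * x - 3))) + 2 * E ^+ 2 / x ^+ 2 =
   E * (1 - ((x - 3) / ((x + 1) * (2 * x - 3)) - 2 * E / x ^+ 2)).
  by field; do ?[apply/andP; split]; apply/eqP; lra.
rewrite ger_pMr; last by lra.
rewrite lerBlDr lerDl subr_ge0 ler_pdivrMr; last by nra.
rewrite mulrAC ler_pdivlMr; last by nra.
suff : 55 / 10 * ((x + 1) * (2 * x - 3)) <= (x - 3) * x ^+ 2.
  have : 0 <= (x + 1) * (2 * x - 3) by nra.
  by nra.
suff : 0 <= (x - 14) * (x ^+ 2 + 11 / 2) by nra.
by apply: mulr_ge0; nra.
Qed.

Lemma round_law_mean_e n : (2 <= n)%N -> \sum_(k < n.+1) Q n k * k%:R <= n%:R / e.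
Proof.
move=> n2; rewrite round_law_mean // ler_wpM2l //.
by have := @pow_pred_le R n.-1; case: n n2 => [|[|n]] //= _; apply.
Qed.

End InverseMoment.

Section TestFunction.
Variable R : realType.
Local Notation Q := (@round_law R).
Local Notation e := (expR 1 : R).

Lemma exists_pow2_ge (x : R) : exists j : nat, x <= 2 ^+ j.
Proof.
have [x0|x0] := leP x 0; first by exists 0; rewrite (le_trans x0).
exists (Num.truncn x).+1; have /andP[_ /ltW xt] := truncn_itv (ltW x0).
by rewrite (le_trans xt) // -natrX ler_nat ltnW // ltn_expl.
Qed.

Definition test_fun (a : R) (n : nat) : R := n%:R / a + a / n.+1%:R - 2.

Lemma test_funE a n : 0 < a ->
  test_fun a n = (n.+1%:R - a) ^+ 2 / (n.+1%:R * a) - a^-1.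
Proof.
move=> a0; rewrite /test_fun -natr1.
have : (n%:R + 1 : R) != 0 by rewrite natr1 pnatr_eq0.
move: n%:R => x x0; field.
by rewrite x0 gt_eqF.
Qed.

(** The two moment inequalities are exactly what is needed. *)
Lemma test_fun_step a n : 0 < a -> (14 <= n)%N ->
  \sum_(k < n.+1) Q n k * test_fun a k <= test_fun (e * a) n.
Proof.
move=> a0 n14; have n2 : (2 <= n)%N by apply: leq_trans n14.
have -> : \sum_(k < n.+1) Q n k * test_fun a k =
    a^-1 * (\sum_(k < n.+1) Q n k * k%:R) +
    a * (\sum_(k < n.+1) Q n k / k.+1%:R) - 2 * \sum_(k < n.+1) Q n k.
  rewrite !mulr_sumr -big_split -sumrB; apply: eq_bigr => k _ /=.
  by rewrite /test_fun; ring.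
rewrite sum_round_law // mulr1 lerD2r; apply: lerD.
  rewrite invfM mulrA [leRHS]mulrC ler_wpM2l ?invr_ge0 ?(ltW a0) //.
  exact: round_law_mean_e.
by rewrite [e * a]mulrC -mulrA ler_wpM2l ?(ltW a0) // inverse_moment_e.
Qed.

Variable f : nat -> R.
Hypothesis f_le1 : forall n, f n <= 1.
Hypothesis f_rec : forall n, (2 <= n)%N -> f n = \sum_(k < n.+1) Q n k * f k.

Definition dominated (M K a : R) := forall n, f n <= M + K * test_fun a n.

(** One round later everything has grown by the factor [e]; below [14] people
    the test function exceeds all probabilities. *)
Lemma dominated_step M K a : 0 <= K -> 0 < a -> 1 <= M + K * (a / 7 - 2) ->
  dominated M K a -> dominated M K (e * a).
Proof.
move=> K0 a0 small dom n; have E2 := e_ge2 R.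
have [n14|n14] := leqP 14 n.
  have n2 : (2 <= n)%N by apply: leq_trans n14.
  rewrite f_rec // (le_trans (y := \sum_(k < n.+1) Q n k * (M + K * test_fun a k))) //.
    by apply: ler_sum => k _; rewrite ler_wpM2l ?round_law_ge0.
  rewrite (eq_bigr (fun k : 'I_n.+1 => M * Q n k + K * (Q n k * test_fun a k))); last first.
    by move=> k _; ring.
  rewrite big_split -!mulr_sumr /= sum_round_law // mulr1 lerD2l ler_wpM2l //.
  exact: test_fun_step.
apply: (le_trans (f_le1 n)); apply: (le_trans small); rewrite lerD2l ler_wpM2l //.
rewrite /test_fun lerD2r.
have : 0 <= n%:R / (e * a) by rewrite divr_ge0 // mulr_ge0 ?expR_ge0 // ltW.
move=> na; suff /le_trans : a / 7 <= e * a / n.+1%:R by apply; rewrite lerDr.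
rewrite ler_pdivlMr // mulrAC ler_pdivrMr //.
have : n.+1%:R <= 14 :> R by rewrite ler_nat.
by nra.
Qed.

(** Dividing [n.+1] by powers of [e] leads into the window, and
    [test_fun n.+1 n = - 1 / n.+1]. *)
Lemma dominated_window M K A B : 0 <= K -> 0 < A -> 1 <= M + K * (A / 7 - 2) ->
  e * A <= B -> (forall a, A <= a <= B -> dominated M K a) ->
  forall n, A <= n.+1%:R -> f n <= M.
Proof.
move=> K0 A0 small AB dom n An; have E2 := e_ge2 R.
have E0 : 0 < e by lra.
have dom_j (j : nat) a : A <= a <= 2 ^+ j * B -> dominated M K a.
  elim: j a => [|j IHj] a /andP[Aa aB]; first by apply: dom; rewrite Aa -[B]mul1r.
  have [aB'|Ba] := leP a B; first by apply: dom; rewrite Aa.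
  have -> : a = e * (a / e) by rewrite mulrC divfK // gt_eqF.
  have Aae : A <= a / e by rewrite ler_pdivlMr //; nra.
  apply: dominated_step => //; first by apply: lt_le_trans Aae.
    by apply: (le_trans small); rewrite lerD2l ler_wpM2l // lerD2r ler_pM2r // invr_gt0.
  apply: IHj; rewrite Aae /= ler_pdivrMr //.
  have a0 : 0 < a by apply: lt_le_trans Aa.
  by move: aB; rewrite exprS; nra.
have : dominated M K n.+1%:R.
  have B0 : 0 < B by apply: lt_le_trans AB; rewrite mulr_gt0.
  have [j jB] := exists_pow2_ge (n.+1%:R / B).
  by apply: (dom_j j); rewrite An -ler_pdivrMr.
move=> /(_ n) /le_trans; apply; rewrite test_funE // subrr expr0n mul0r add0r.
by rewrite gerDl mulrN oppr_le0 mulr_ge0.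
Qed.

(** For [b] between [n] and [n.+1], [test_fun b n <= 1 / (b (n + 1)) - 1 / b]
    is not positive. *)
Lemma dominated_infinitely M K a : 0 <= K -> 0 < a -> 1 <= M + K * (a / 7 - 2) ->
  dominated M K a -> forall N, exists2 n, (N <= n)%N & f n <= M.
Proof.
move=> K0 a0 small dom N; have E2 := e_ge2 R.
have dom_j j : exists2 b, 2 ^+ j * a <= b & dominated M K b.
  elim: j => [|j [b ab domb]]; first by exists a; rewrite ?mul1r.
  have bb : a <= b by apply: le_trans ab; rewrite ler_peMl ?(ltW a0) // exprn_ege1 ?ler1n.
  have b0 : 0 < b by apply: lt_le_trans bb.
  exists (e * b); first by rewrite exprS; nra.
  apply: dominated_step => //.
  by apply: (le_trans small); rewrite lerD2l ler_wpM2l // lerD2r ler_pM2r // invr_gt0.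
have [b Nb domb] : exists2 b, N%:R + 1 <= b & dominated M K b.
  have [j jN] := exists_pow2_ge ((N%:R + 1) / a); have [b jb domb] := dom_j j.
  by exists b => //; apply: le_trans jb; rewrite -ler_pdivrMr.
have b0 : 0 < b by apply: lt_le_trans Nb; rewrite ltr_pwDr.
have /andP[tb bt] := truncn_itv (ltW b0).
exists (Num.truncn b).
  by rewrite -ltnS -(ltr_nat R) (le_lt_trans _ bt) // (le_trans _ Nb) // lerDl.
apply: (le_trans (domb _)); rewrite gerDl mulr_ge0_le0 // test_funE //.
rewrite subr_le0 -[leRHS]mul1r invfM mulrA ler_pM2r ?invr_gt0 // ler_pdivrMr // mul1r.
move: bt tb; rewrite -natr1; set t := _%:R => bt tb.
have t0 : 0 <= t by [].
by nra.
Qed.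

End TestFunction.

(** * A floating point computation of the law of a round *)

Local Close Scope ring_scope.
Local Open Scope N_scope.

(** The pair [(m, e)] stands for [m * 2 ^ e].  All operations round down. *)
Definition float := (N * N)%type.

(** Multiplication by a number of people adds at most [11] bits to a mantissa;
    those that are cut back keep at least [34]. *)
Definition fnorm (m e : N) : float :=
  if m <? 2 ^ 44 then (m, e) else (N.shiftr m 11, e + 11).

Definition fadd (x y : float) : float :=
  let (m1, e1) := x in
  let (m2, e2) := y in
  match e1 ?= e2 with
  | Eq => fnorm (m1 + m2) e1
  | Lt => fnorm (N.shiftr m1 (e2 - e1) + m2) e2
  | Gt => fnorm (m1 + N.shiftr m2 (e1 - e2)) e1
  end.

Definition fscale (r : N) (x : float) : float := let (m, e) := x in (r * m, e).

(** The entry [x] of a row belongs to [k] survivors among [n] people, [prev] to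
    [k.-1], and [r = n - k.-1]; see [round_weight_rec]. *)
Fixpoint next_row (ext : bool) (r : N) (prev : float) (row : seq float) : seq float :=
  match row with
  | [::] => if ext then [:: let (m, e) := fscale r prev in fnorm m e] else [::]
  | x :: row' => fadd (fscale r prev) x :: next_row ext (N.pred r) x row'
  end.

(** The sums of [x * a * 2 ^ (- d)] and [x * b * 2 ^ (- d)] in units of [2 ^ D],
    over the entries [x] of the row and [(a, b, d)] of the table. *)
Fixpoint dot (D : N) (row : seq float) (tab : seq (N * N * N)) (T1 T2 : N) : N * N :=
  match row, tab with
  | (m, e) :: row', (a, b, d) :: tab' =>
      let m' := N.shiftr m 17 in
      let sh := (D + d) - (e + 17) in
      dot D row' tab' (N.shiftr (a * m') sh + T1) (N.shiftr (b * m') sh + T2)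
  | _, _ => (T1, T2)
  end.

(** Powers of the fraction [y / 2 ^ 40], in the same units. *)
Fixpoint fpow (y : N) (p : positive) : N :=
  match p with
  | xH => y
  | xO q => let z := fpow y q in N.shiftr (z * z) 40
  | xI q => let z := fpow y q in N.shiftr (N.shiftr (z * z) 40 * y) 40
  end.

Definition growth_approx (n : N) : N :=
  N.succ n * fpow (N.shiftl (N.pred n) 40 / n) (N.succ_pos (N.pred n)) / n.

Fixpoint factN (n : nat) : N := if n is k.+1 then N.of_nat n * factN k else 1.

Fixpoint subfactN (n : nat) : N :=
  if n is k.+1 then
    if odd k then N.of_nat n * subfactN k + 1 else N.of_nat n * subfactN k - 1
  else 1.

(** The weight of the derangements of [n] people, in units of [2 ^ (- 100)].
    It tends to [1 / e] alternatingly, so that its value at the odd number [15]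
    is a lower bound for all larger [n]. *)
Definition source (n : N) : float :=
  let k := if n <? 15 then N.to_nat n else 15%N in
  (N.shiftl (subfactN k) 44 / factN k, 56).

(** After [n = st_people] people: the row of weights, starting with
    [st_first] survivors and ending with [st_last]; lower bounds
    [st_normm * 2 ^ (- st_norme)] of [n! / (n - 1) ^ n] and
    [st_factm * 2 ^ (- st_facte)] of [1 / n!]; the table of the values
    [g1 k / k!] and [g2 k / k!] for [dot]; and, from [n] down to [0], the lower
    bounds of [g1] and [g2] in units of [2 ^ (- 30)]. *)
Record state := State {
  st_people : N;
  st_first : N;
  st_row : seq float;
  st_last : N;
  st_normm : N;
  st_norme : N;
  st_factm : N;
  st_facte : N;
  st_table : seq (N * N * N);
  st_bounds : seq (N * N)
}.

(** The number of survivors has mean [n / e] and standard deviation about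
    [0.31 * sqrt n], so that the band is about five standard deviations wide on
    either side. *)
Definition band (n : N) : N := 16 * N.sqrt n / 10 + 2.
Definition mean (n : N) : N := n * 36788 / 100000.

(** [ext] adds one entry at the end of the row; [keep] says that the first
    entry is kept. *)
Definition advance_row (ext keep : bool) (s : state) : N * seq float :=
  if st_row s is x :: row then
    let row' := next_row ext (st_people s - st_first s) x row in
    if keep then
      (st_first s, (if st_first s =? 0 then source (N.succ (st_people s)) else x) :: row')
    else (N.succ (st_first s), row')
  else (st_first s, [::]).

(** The rate lies between [1/4] and [1/2], so that a shift by [38] instead of
    [40] keeps the mantissa from shrinking; the exponent grows by the other two
    bits. *)
Definition advance_norm (s : state) : float :=
  let t := N.shiftr (st_normm s * growth_approx (st_people s)) 38 in
  let e := st_norme s + 2 in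
  if t <? 2 ^ 41 then (t, e) else (N.shiftr t 1, e - 1).

Definition advance (s : state) : state :=
  let n := N.succ (st_people s) in
  let (t, e) := advance_norm s in
  let ext := st_last s <? mean n + band n in
  let last' := if ext then N.succ (st_last s) else st_last s in
  (* Going backwards from the mean number of survivors among 1319 people, the
     recursion draws on numbers of survivors close to a parabola; entries well
     below it are dropped. *)
  let (first', row') := advance_row ext (n * n / 4500 <=? st_first s + 12) s in
  let k0 := N.max (mean n - band n) first' in
  let (T1, T2) := dot (e + 28) (drop (N.to_nat (k0 - first')) row')
                      (drop (N.to_nat k0) (st_table s)) 0 0 in
  let lo := N.shiftr (T1 * t) 42 in
  let co := N.shiftr (T2 * t) 42 in
  (* The 11 new bits make up for the division by n < 2 ^ 11. *)
  let u := N.shiftl (st_factm s) 11 / n in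
  let d := N.size u - 40 in
  let u := N.shiftr u d in
  let fe := st_facte s + 11 - d in
  (* The bounds have 30 fractional bits, hence the exponent decreases by
     48 - 30 only.  The band for 1319 people ends below 600. *)
  let table' :=
    if n <? 600
    then st_table s ++ [:: (N.shiftr (lo * u) 48, N.shiftr (co * u) 48, fe - 18)]
    else st_table s in
  State n first' row' last' t e u fe table' ((lo, co) :: st_bounds s).

(** At [0], [1], [2] the values of [g1] are [1, 0, 1] and those of [g2] are
    [0, 1, 0]. *)
Definition start : state :=
  State 2 0 [:: source 2] 0 (2 ^ 40) 39 (2 ^ 39) 40
    [:: (2 ^ 24, 0, 24); (0, 2 ^ 24, 24); (2 ^ 23, 0, 24)]
    [:: (2 ^ 30, 0); (0, 2 ^ 30); (2 ^ 30, 0)].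

Local Close Scope N_scope.
Local Open Scope ring_scope.

Section Soundness.
Variable R : realType.

Definition N2R (x : N) : R := (N.to_nat x)%:R.

Lemma N2R_ge0 x : 0 <= N2R x. Proof. exact: ler0n. Qed.

Lemma N2RD x y : N2R (x + y)%num = N2R x + N2R y.
Proof. by rewrite /N2R N2Nat.inj_add natrD. Qed.

Lemma N2RM x y : N2R (x * y)%num = N2R x * N2R y.
Proof. by rewrite /N2R N2Nat.inj_mul natrM. Qed.

Lemma N2RS x : N2R (N.succ x) = N2R x + 1.
Proof. by rewrite /N2R N2Nat.inj_succ natr1. Qed.

Lemma N2R_le x y : (x <= y)%num -> N2R x <= N2R y.
Proof. by move=> xy; rewrite ler_nat; lia. Qed.

Lemma N2R_leb x y : (x <=? y)%num -> N2R x <= N2R y.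
Proof. by move=> /N.leb_le; exact: N2R_le. Qed.

Lemma N2R_of_nat n : N2R (N.of_nat n) = n%:R.
Proof. by rewrite /N2R Nat2N.id. Qed.

Lemma N2RX x y : N2R (x ^ y)%num = N2R x ^+ N.to_nat y.
Proof.
rewrite /N2R N2Nat.inj_pow.
by elim: (N.to_nat y) => //= n IHn; rewrite natrM IHn exprS.
Qed.

Lemma N2R_sub x y : N2R x - N2R y <= N2R (x - y)%num.
Proof. by rewrite lerBlDr -N2RD; apply: N2R_le; lia. Qed.

Lemma N2R_subE x y : (y <= x)%num -> N2R (x - y)%num = N2R x - N2R y.
Proof. by move=> yx; apply/eqP; rewrite eq_sym subr_eq -N2RD N.sub_add. Qed.

Lemma N2R_div x y : N2R (x / y)%num * N2R y <= N2R x.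
Proof.
rewrite -N2RM; apply: N2R_le; case: y => [|p]; first by rewrite N.mul_0_r; lia.
by rewrite N.mul_comm; exact: N.Div0.mul_div_le.
Qed.

Lemma pow2_ge0 (n : nat) : 0 <= 2 ^+ n :> R. Proof. exact: exprn_ge0. Qed.

Lemma N2R_shiftr x k : N2R (N.shiftr x k) * 2 ^+ N.to_nat k <= N2R x.
Proof. by have := N2R_div x (2 ^ k)%num; rewrite N.shiftr_div_pow2 N2RX. Qed.

Lemma N2R_shiftl x k : N2R (N.shiftl x k) = N2R x * 2 ^+ N.to_nat k.
Proof. by rewrite N.shiftl_mul_pow2 N2RM N2RX. Qed.

(** For [d <= e] this is the defining property of the shift, multiplied by a
    power of [2]; for larger [d] the truncated difference is [0], but then
    [2 ^ e <= 2 ^ d]. *)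
Lemma N2R_shiftr_sub x d (e : N) :
  N2R (N.shiftr x d) * 2 ^+ N.to_nat e <= N2R x * 2 ^+ N.to_nat (e - d).
Proof.
apply: (@le_trans _ _ (N2R (N.shiftr x d) * (2 ^+ N.to_nat d * 2 ^+ N.to_nat (e - d)))).
  by rewrite ler_wpM2l ?N2R_ge0 // -exprD ler_weXn2l ?ler1n //; lia.
by rewrite mulrA ler_wpM2r ?pow2_ge0 // N2R_shiftr.
Qed.

Definition float_val (x : float) : R := N2R x.1 * 2 ^+ N.to_nat x.2.

Lemma float_val_ge0 x : 0 <= float_val x.
Proof. by rewrite mulr_ge0 ?N2R_ge0 ?pow2_ge0. Qed.

Lemma fnorm_le m e : float_val (fnorm m e) <= float_val (m, e).
Proof.
rewrite /fnorm; case: ifP => // _; rewrite /float_val /= N2Nat.inj_add exprD.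
rewrite (mulrC (2 ^+ _)) mulrA ler_wpM2r ?pow2_ge0 //.
exact: (N2R_shiftr m 11).
Qed.

Lemma fadd_le x y : float_val (fadd x y) <= float_val x + float_val y.
Proof.
case: x y => [m1 e1] [m2 e2]; rewrite /fadd.
have align m d e : float_val (N.shiftr m d, e) <= float_val (m, (e - d)%num).
  exact: N2R_shiftr_sub.
have sumE m m' e : float_val ((m + m')%num, e) = float_val (m, e) + float_val (m', e).
  by rewrite /float_val N2RD mulrDl.
case: N.compare_spec => [->|lt|lt]; apply: (le_trans (fnorm_le _ _)); rewrite sumE //.
  rewrite lerD2r; apply: le_trans (align _ _ _) _.
  by rewrite (_ : e2 - (e2 - e1) = e1)%num //; lia.
rewrite lerD2l; apply: le_trans (align _ _ _) _.
by rewrite (_ : e1 - (e1 - e2) = e2)%num //; lia.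
Qed.

Lemma fscaleE r x : float_val (fscale r x) = N2R r * float_val x.
Proof. by case: x => m e; rewrite /float_val /= N2RM mulrA. Qed.

(** In this normalization [round_count_rec] needs no division and only
    multiplications by small integers. *)
Definition round_weight (n k : nat) : R := k`!%:R * (round_count n k)%:R / n`!%:R.

Lemma round_weight_ge0 n k : 0 <= round_weight n k.
Proof. by rewrite divr_ge0 ?mulr_ge0. Qed.

Lemma round_weight_rec n k :
  round_weight n.+1 k.+1 = (n - k)%:R * round_weight n k + round_weight n k.+1.
Proof.
rewrite /round_weight; have [kn|nk] := leqP k n; last first.
  have nk1 : (n < k.+1)%N by exact: ltnW.
  by rewrite !round_count_eq0 // !mulr0 !mul0r mulr0 addr0.
have eqr := congr1 (fun i => i%:R : R) (round_count_rec kn).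
rewrite natrM natrM natrD !natrM in eqr; rewrite !factS !natrM.
have k0 : k.+1%:R != 0 :> R by rewrite pnatr_eq0.
have n0 : n.+1%:R != 0 :> R by rewrite pnatr_eq0.
have f0 : n`!%:R != 0 :> R by rewrite pnatr_eq0 -lt0n fact_gt0.
rewrite [k.+1%:R * _]mulrC -[_ * _ * (round_count n.+1 k.+1)%:R]mulrA eqr.
move: (n.+1%:R) n0 (n`!%:R) f0 (k.+1%:R) => N N0 F F0 K.
by field; rewrite F0 N0.
Qed.

Lemma round_weight_mono n k : (0 < k)%N -> round_weight n k <= round_weight n.+1 k.
Proof.
by case: k => // k _; rewrite round_weight_rec lerDr mulr_ge0 // round_weight_ge0.
Qed.

Lemma round_law_weight n k : (2 <= n)%N ->
  round_law R n k = n`!%:R / (n.-1 ^ n)%:R * (round_weight n k / k`!%:R).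
Proof.
move=> n2; rewrite /round_law /round_weight.
have := selections_neq0 R n2.
have : k`!%:R != 0 :> R by rewrite pnatr_eq0 -lt0n fact_gt0.
have : n`!%:R != 0 :> R by rewrite pnatr_eq0 -lt0n fact_gt0.
by move: (n`!%:R) (k`!%:R) (_ ^ _)%:R => F K P F0 K0 P0; field; rewrite F0 K0 P0.
Qed.

(** The factor [2 ^ 100] keeps the exponents of all entries nonnegative. *)
Fixpoint row_ok (n k : nat) (row : seq float) : Prop :=
  if row is x :: row' then float_val x <= 2 ^+ 100 * round_weight n k /\ row_ok n k.+1 row'
  else True.

Lemma next_row_ok ext r n k prev row :
  N.to_nat r = (n - k)%N -> float_val prev <= 2 ^+ 100 * round_weight n k ->
  row_ok n k.+1 row -> row_ok n.+1 k.+1 (next_row ext r prev row).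
Proof.
elim: row r k prev => [|x row IHrow] r k prev rE prevP /=.
  case: ext => // _; split => //; rewrite round_weight_rec.
  have -> : (let (m, e) := fscale r prev in fnorm m e) =
      fnorm (fscale r prev).1 (fscale r prev).2 by case: fscale.
  apply: le_trans (fnorm_le _ _) _; rewrite -surjective_pairing fscaleE /N2R rE.
  rewrite mulrDr [2 ^+ 100 * (_ * _)]mulrCA.
  apply: (@le_trans _ _ ((n - k)%:R * (2 ^+ 100 * round_weight n k))).
    by rewrite ler_wpM2l.
  by rewrite lerDl mulr_ge0 ?round_weight_ge0 ?pow2_ge0.
move=> [xP rowP]; split; last first.
  by apply: IHrow => //; rewrite N2Nat.inj_pred rE; lia.
apply: le_trans (fadd_le _ _) _; rewrite round_weight_rec mulrDr lerD //.
by rewrite fscaleE /N2R rE [leRHS]mulrCA ler_wpM2l.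
Qed.

Lemma row_ok_drop n k j row : row_ok n k row -> row_ok n (k + j)%N (drop j row).
Proof.
elim: j k row => [|j IHj] k [|x row] //=; rewrite ?addn0 // => -[_ rowP].
by rewrite addnS -addSn; exact: IHj.
Qed.

End Soundness.

Section Ingredients.
Variable R : realType.
Local Notation toR := (N2R R).

Lemma N2R_factN n : toR (factN n) = n`!%:R.
Proof.
elim: n => // n IHn; rewrite -[factN n.+1]/(N.of_nat n.+1 * factN n)%num.
by rewrite N2RM IHn factS natrM N2R_of_nat.
Qed.

Definition inv_e_sum (n : nat) : R := \sum_(j < n.+1) (-1) ^+ j / j`!%:R.

Lemma inv_e_sumS n :
  inv_e_sum n.+1 = inv_e_sum n + (-1) ^+ n.+1 / n.+1`!%:R.
Proof. by rewrite /inv_e_sum big_ord_recr. Qed.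

(** After an odd index the following terms can be paired into nonnegative
    sums. *)
Lemma inv_e_sum_odd m n : odd m -> (m <= n)%N -> inv_e_sum m <= inv_e_sum n.
Proof.
move=> mo; have even_step i : inv_e_sum m <= inv_e_sum (m + i.*2).
  elim: i => [|i IHi]; first by rewrite addn0.
  apply: (le_trans IHi); rewrite doubleS !addnS !inv_e_sumS -addrA lerDl.
  rewrite -signr_odd /= oddD odd_double addbF mo expr0.
  rewrite -signr_odd /= oddD odd_double addbF mo expr1 mulN1r subr_ge0 mul1r.
  by rewrite lef_pV2 ?posrE ?ltr0n ?fact_gt0 // ler_nat leq_pmull.
move=> mn; rewrite -(subnKC mn) -(odd_double_half (n - m)) addnCA.
case: odd; last exact: even_step.
rewrite add1n inv_e_sumS; apply: (le_trans (even_step (n - m)./2)).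
rewrite lerDl -signr_odd /= oddD odd_double addbF mo expr0.
by rewrite divr_ge0.
Qed.

Lemma N2R_subfactN n : toR (subfactN n) = n`!%:R * inv_e_sum n.
Proof.
have pos k : ~~ odd k -> (1 <= subfactN k)%num.
  by case: k => [|k] //; rewrite oddS negbK /subfactN -/subfactN => ->; lia.
elim: n => [|n IHn]; first by rewrite /inv_e_sum big_ord1 expr0 divr1 mul1r.
have f0 : n.+1`!%:R != 0 :> R by rewrite pnatr_eq0 -lt0n fact_gt0.
rewrite inv_e_sumS mulrDr mulrCA mulfV // mulr1 factS natrM -mulrA -IHn -N2R_of_nat -N2RM.
rewrite /subfactN -/subfactN; have : ~~ odd n -> (1 <= N.of_nat n.+1 * subfactN n)%num.
  by move=> /pos; nia.
move: (_ * subfactN n)%num => X X1; rewrite -signr_odd /=; case: (boolP (odd n)) => /= on.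
  by rewrite expr0 N2RD.
rewrite expr1; apply/eqP; rewrite eq_sym subr_eq -[1]/(toR 1) -N2RD; apply/eqP; congr (toR _).
by have := X1 on; lia.
Qed.

Lemma source_le (n : N) : float_val R (source n) <= 2 ^+ 100 * round_weight R (N.to_nat n) 0.
Proof.
have le_weight m : inv_e_sum m <= round_weight R m 0.
  by rewrite /round_weight fact0 mul1r; exact: round_count0_ge.
rewrite /source; set k := if _ then _ else _.
have kn : inv_e_sum k <= round_weight R (N.to_nat n) 0.
  apply: le_trans (le_weight _); rewrite /k; case: N.ltb_spec => // n15.
  by apply: inv_e_sum_odd => //; lia.
rewrite (_ : 100 = 44 + 56)%N // exprD -mulrA mulrCA mulrC /float_val.
rewrite ler_wpM2r ?pow2_ge0 //.
apply: (@le_trans _ _ (2 ^+ 44 * inv_e_sum k)); last by rewrite ler_wpM2l ?pow2_ge0.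
have f0 : 0 < k`!%:R :> R by rewrite ltr0n fact_gt0.
rewrite -(ler_pM2r f0) -N2R_factN; apply: le_trans (N2R_div _ _ _) _.
rewrite N2R_shiftl N2R_subfactN N2R_factN [leLHS]mulrC -[leRHS]mulrA [inv_e_sum k * _]mulrC.
exact: lexx.
Qed.

Lemma shiftr_mul40 a b :
  toR (N.shiftr (a * b) 40) / 2 ^+ 40 <= (toR a / 2 ^+ 40) * (toR b / 2 ^+ 40).
Proof.
have : toR (N.shiftr (a * b) 40) * 2 ^+ 40 <= toR a * toR b.
  by rewrite -N2RM; exact: (N2R_shiftr R (a * b) 40).
have : 0 < 2 ^+ 40 :> R by exact: exprn_gt0.
move: (2 ^+ 40) => P P0; rewrite -ler_pdivlMr // ler_pdivrMr // => /le_trans; apply.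
by rewrite mulrACA -[leRHS]mulrA mulfVK ?gt_eqF.
Qed.

Lemma fpow_le y p : toR (fpow y p) / 2 ^+ 40 <= (toR y / 2 ^+ 40) ^+ Pos.to_nat p.
Proof.
have q0 x : 0 <= toR x / 2 ^+ 40 by rewrite divr_ge0 ?N2R_ge0 ?pow2_ge0.
move: (2 ^+ 40) q0 shiftr_mul40 => P q0 mulP.
elim: p => [p IHp|p IHp|]; rewrite /fpow -/fpow.
- rewrite Pos2Nat.inj_xI exprS [leRHS]mulrC multE mulnC exprM expr2.
  apply: le_trans (mulP _ _) _; rewrite ler_wpM2r //.
  by apply: le_trans (mulP _ _) _; rewrite ler_pM.
- rewrite Pos2Nat.inj_xO multE mulnC exprM expr2.
  by apply: le_trans (mulP _ _) _; rewrite ler_pM.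
- by rewrite Pos2Nat.inj_1 expr1.
Qed.

Lemma growth_approx_le (n : N) : (2 <= N.to_nat n)%N ->
  toR (growth_approx n) <= 2 ^+ 40 * growth R (N.to_nat n).
Proof.
move=> n2; have nR : 0 < toR n by rewrite ltr0n; exact: leq_trans n2.
have p0 : 0 < 2 ^+ 40 :> R by exact: exprn_gt0.
rewrite /growth_approx -(ler_pM2r nR); apply: le_trans (N2R_div _ _ _) _.
set y := (_ / n)%num; set p := N.succ_pos _.
have pE : Pos.to_nat p = N.to_nat n.
  by have := N.succ_pos_spec (N.pred n); rewrite -/p; lia.
have yP : toR y / 2 ^+ 40 <= (N.to_nat n).-1%:R / toR n.
  rewrite ler_pdivrMr // mulrAC ler_pdivlMr //; apply: le_trans (N2R_div _ _ _) _.
  by rewrite N2R_shiftl /toR N2Nat.inj_pred.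
rewrite N2RM /growth; set nn := N.to_nat n in pE yP *.
have : toR (fpow y p) <= 2 ^+ 40 * ((nn.-1)%:R / toR n) ^+ nn.
  rewrite mulrC -ler_pdivrMr //; apply: le_trans (fpow_le _ _) _.
  by rewrite pE lerXn2r // nnegrE divr_ge0 ?N2R_ge0 ?pow2_ge0.
have nE : toR n = nn%:R by [].
move=> /(ler_wpM2l (N2R_ge0 R (N.succ n))) /le_trans; apply.
rewrite nE in nR *; rewrite N2RS nE natr1 expr_div_n [nn%:R ^+ nn.+1]exprS.
have : nn%:R ^+ nn != 0 :> R by rewrite expf_neq0 // gt_eqF.
have : nn%:R != 0 :> R by rewrite gt_eqF.
move: nn.+1%:R nn%:R (nn%:R ^+ nn) (nn.-1%:R ^+ nn) (2 ^+ 40) => a b c d q b0 c0.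
suff -> : a * (q * (d / c)) = q * (a * (d / (b * c))) * b by [].
by field; rewrite b0 c0.
Qed.

End Ingredients.

Section StateSoundness.
Variable R : realType.
Local Notation toR := (N2R R).
Local Notation fval := (float_val R).
Local Notation weight := (round_weight R).

Definition round_invariant (g : nat -> R) :=
  (forall n, 0 <= g n) /\
  (forall n, (2 <= n)%N -> g n = \sum_(k < n.+1) round_law R n k * g k).

Fixpoint table_ok (g : nat -> R) (sel : N * N * N -> N) (k : nat)
    (tab : seq (N * N * N)) : Prop :=
  if tab is x :: tab' then
    toR (sel x) * k`!%:R <= g k * 2 ^+ N.to_nat x.2 /\ table_ok g sel k.+1 tab'
  else True.

Lemma table_ok_drop g sel k j tab :
  table_ok g sel k tab -> table_ok g sel (k + j)%N (drop j tab).
Proof.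
elim: j k tab => [|j IHj] k [|x tab] //=; rewrite ?addn0 // => -[_ tabP].
by rewrite addnS -addSn; exact: IHj.
Qed.

Lemma table_ok_rcons g sel k tab x : table_ok g sel k tab ->
  toR (sel x) * (k + size tab)`!%:R <= g (k + size tab)%N * 2 ^+ N.to_nat x.2 ->
  table_ok g sel k (tab ++ [:: x]).
Proof.
elim: tab k => [|y tab IHtab] k /=; first by rewrite addn0.
by move=> [yP tabP] xP; split=> //; apply: IHtab => //; rewrite addSnnS.
Qed.

Lemma term_le (D m e a d : N) (w g : R) (k : nat) :
  0 <= g -> fval (m, e) <= 2 ^+ 100 * w ->
  toR a * k`!%:R <= g * 2 ^+ N.to_nat d ->
  toR (N.shiftr (a * N.shiftr m 17) ((D + d) - (e + 17)))%num * 2 ^+ N.to_nat D <=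
  2 ^+ 100 * (w * (g / k`!%:R)).
Proof.
move=> g0 mP aP.
set T := toR (N.shiftr _ _).
have F0 : 0 < k`!%:R :> R by rewrite ltr0n fact_gt0.
have d0 : 0 < 2 ^+ N.to_nat d :> R by exact: exprn_gt0.
have shP : T * 2 ^+ N.to_nat (D + d) <= toR a * fval (m, e).
  apply: (@le_trans _ _ (toR (a * N.shiftr m 17) * 2 ^+ N.to_nat (e + 17))).
    apply: (@le_trans _ _ (toR (a * N.shiftr m 17) *
        2 ^+ N.to_nat ((D + d) - ((D + d) - (e + 17))))); first exact: N2R_shiftr_sub.
    by rewrite ler_wpM2l ?N2R_ge0 // ler_weXn2l ?ler1n //; lia.
  rewrite N2RM -mulrA ler_wpM2l ?N2R_ge0 // N2Nat.inj_add exprD mulrCA mulrC.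
  by rewrite /float_val ler_wpM2r ?pow2_ge0 //; exact: (N2R_shiftr R m 17).
rewrite -(ler_pM2r d0) -(ler_pM2r F0) -[T * _ * _]mulrA -exprD -plusE -N2Nat.inj_add.
apply: (@le_trans _ _ (toR a * (2 ^+ 100 * w) * k`!%:R)).
  rewrite ler_wpM2r ?(ltW F0) //; apply: (le_trans shP).
  by rewrite ler_wpM2l ?N2R_ge0.
have W0 : 0 <= 2 ^+ 100 * w by apply: le_trans mP; exact: float_val_ge0.
rewrite mulrAC; apply: (le_trans (ler_wpM2r W0 aP)).
move: (2 ^+ 100) (2 ^+ N.to_nat d) => p q.
suff -> : p * (w * (g / k`!%:R)) * q * k`!%:R = g * q * (p * w) by [].
by field; rewrite gt_eqF.
Qed.

Lemma dot_ok (g1 g2 : nat -> R) D n k row tab T1 T2 :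
  (forall i, 0 <= g1 i) -> (forall i, 0 <= g2 i) ->
  row_ok R n k row -> table_ok g1 (fun x => x.1.1) k tab ->
  table_ok g2 (fun x => x.1.2) k tab ->
  toR (dot D row tab T1 T2).1 * 2 ^+ N.to_nat D <= toR T1 * 2 ^+ N.to_nat D +
    2 ^+ 100 * \sum_(k <= i < k + size row) weight n i * (g1 i / i`!%:R) /\
  toR (dot D row tab T1 T2).2 * 2 ^+ N.to_nat D <= toR T2 * 2 ^+ N.to_nat D +
    2 ^+ 100 * \sum_(k <= i < k + size row) weight n i * (g2 i / i`!%:R).
Proof.
move=> g10 g20 rowP tab1 tab2.
have h0 g : (forall i, 0 <= g i) -> forall a b,
    0 <= \sum_(a <= i < b) weight n i * (g i / i`!%:R).
  by move=> g0 a b; apply: sumr_ge0 => i _; rewrite mulr_ge0 ?round_weight_ge0 ?divr_ge0.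
elim: row k tab T1 T2 rowP tab1 tab2 => [|[m e] row IHrow] k [|[[a b] d] tab] T1 T2 /=;
  try by move=> *; split; rewrite lerDl mulr_ge0 ?pow2_ge0 ?h0.
move=> [mP rowP] [aP tab1] [bP tab2].
have [le1 le2] := IHrow k.+1 tab
  (N.shiftr (a * N.shiftr m 17) ((D + d) - (e + 17)) + T1)%num
  (N.shiftr (b * N.shiftr m 17) ((D + d) - (e + 17)) + T2)%num rowP tab1 tab2.
split; [move: le1|move: le2] => /le_trans; apply;
  rewrite N2RD mulrDl -addrA addrCA lerD2l addnS -addSn [in leRHS]big_ltn ?addSn ?ltnS ?leq_addr //;
  rewrite [in leRHS]mulrDr lerD2r; exact: term_le.
Qed.

(** Summing over part of the numbers of survivors gives a lower bound. *)
Lemma round_invariant_ge g n k l : round_invariant g -> (2 <= n)%N ->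
  n`!%:R / (n.-1 ^ n)%:R * \sum_(k <= i < k + l) weight n i * (g i / i`!%:R) <= g n.
Proof.
move=> [g0 grec] n2; pose h i := weight n i * (g i / i`!%:R).
have h0 i : 0 <= h i by rewrite mulr_ge0 ?round_weight_ge0 ?divr_ge0.
have -> : g n = n`!%:R / (n.-1 ^ n)%:R * \sum_(0 <= i < n.+1) h i.
  rewrite grec // big_mkord mulr_sumr; apply: eq_bigr => i _.
  by rewrite round_law_weight // /h -!mulrA [i`!%:R^-1 * _]mulrC.
rewrite ler_wpM2l ?divr_ge0 // -/h.
have tail a b : (n < a)%N -> \sum_(a <= i < b) h i = 0.
  move=> na; rewrite big_nat big1 // => i /andP[ai _].
  by rewrite /h /round_weight round_count_eq0 ?(leq_trans na) // mulr0 !mul0r.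
have -> : \sum_(0 <= i < n.+1) h i = \sum_(0 <= i < n.+1 + (k + l)) h i.
  by rewrite [RHS](big_cat_nat (n := n.+1)) ?leq_addr //= [X in _ + X]tail ?addr0.
rewrite [leRHS](big_cat_nat (n := k)) //=; last by rewrite addnCA leq_addr.
rewrite [X in _ <= _ + X](big_cat_nat (n := k + l)) ?leq_addr ?leq_addl //=.
by rewrite addrCA lerDl addr_ge0 // sumr_ge0.
Qed.

(** Here [2 ^ 100] is the scale of the row, and [28 = 100 - 72] leaves [72]
    bits, of which the final shift by [42] keeps [30]. *)
Lemma bound_le g (n t E T : N) k l : round_invariant g -> (2 <= N.to_nat n)%N ->
  let nn := N.to_nat n in
  toR t <= nn`!%:R / (nn.-1 ^ nn)%:R * 2 ^+ N.to_nat E ->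
  toR T * 2 ^+ N.to_nat (E + 28) <=
    2 ^+ 100 * \sum_(k <= i < k + l) weight nn i * (g i / i`!%:R) ->
  toR (N.shiftr (T * t) 42) <= 2 ^+ 30 * g nn.
Proof.
move=> gh n2 nn tP TP; have le_g := round_invariant_ge k l gh n2.
rewrite -/nn in le_g; move: le_g tP TP.
set nu := _ / _; set S := \sum_(_ <= i < _) _ => le_g tP TP.
have q42 : 0 < 2 ^+ 42 :> R by exact: exprn_gt0.
have qE : 0 < 2 ^+ N.to_nat (E + 28) :> R by exact: exprn_gt0.
have p100 : 0 <= 2 ^+ 100 :> R by exact: pow2_ge0.
have nu0 : 0 <= nu by rewrite divr_ge0.
rewrite -(ler_pM2r q42); apply: le_trans (N2R_shiftr R _ 42) _; rewrite N2RM.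
rewrite -(ler_pM2r qE) mulrAC.
apply: (@le_trans _ _ (2 ^+ 100 * S * (nu * 2 ^+ N.to_nat E))).
  by apply: ler_pM; rewrite ?mulr_ge0 ?N2R_ge0 ?pow2_ge0.
rewrite N2Nat.inj_add exprD.
have -> : 2 ^+ 30 * g nn * 2 ^+ 42 * (2 ^+ N.to_nat E * 2 ^+ N.to_nat 28) =
    2 ^+ 100 * 2 ^+ N.to_nat E * g nn.
  have -> : 2 ^+ 100 = 2 ^+ 30 * 2 ^+ 42 * 2 ^+ N.to_nat 28 :> R by rewrite -!exprD.
  by move: (2 ^+ 30) (2 ^+ 42) (2 ^+ N.to_nat E) (2 ^+ N.to_nat 28) => a b c d; ring.
rewrite [nu * _]mulrC mulrACA [S * _]mulrC ler_wpM2l // mulr_ge0 ?pow2_ge0 //.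
Qed.

Fixpoint bounds_ok (g1 g2 : nat -> R) (l : seq (N * N)) : Prop :=
  if l is x :: l' then
    [/\ toR x.1 <= 2 ^+ 30 * g1 (size l'), toR x.2 <= 2 ^+ 30 * g2 (size l') &
        bounds_ok g1 g2 l']
  else True.

(** The computation runs for two functions at once, which will be [p] and
    [1 - p]: a lower bound of either is an upper bound of the other. *)
Record sound (g1 g2 : nat -> R) (s : state) : Prop := Sound {
  sound_people : (2 <= N.to_nat (st_people s))%N;
  sound_row : row_ok R (N.to_nat (st_people s)) (N.to_nat (st_first s)) (st_row s);
  sound_norm : let n := N.to_nat (st_people s) in
    toR (st_normm s) <= n`!%:R / (n.-1 ^ n)%:R * 2 ^+ N.to_nat (st_norme s);
  sound_fact :
    toR (st_factm s) * (N.to_nat (st_people s))`!%:R <= 2 ^+ N.to_nat (st_facte s);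
  sound_table1 : table_ok g1 (fun x => x.1.1) 0 (st_table s);
  sound_table2 : table_ok g2 (fun x => x.1.2) 0 (st_table s);
  sound_size : (st_people s < 600)%num -> size (st_table s) = (N.to_nat (st_people s)).+1;
  sound_bounds : bounds_ok g1 g2 (st_bounds s);
  sound_bounds_size : size (st_bounds s) = (N.to_nat (st_people s)).+1
}.

Lemma next_norm_le (n m E : N) : let nn := N.to_nat n in (2 <= nn)%N ->
  toR m <= nn`!%:R / (nn.-1 ^ nn)%:R * 2 ^+ N.to_nat E ->
  toR (N.shiftr (m * growth_approx n) 38) <=
    nn.+1`!%:R / (nn ^ nn.+1)%:R * 2 ^+ N.to_nat (E + 2).
Proof.
move=> nn n2 mP.
have q38 : 0 < 2 ^+ 38 :> R by exact: exprn_gt0.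
rewrite -(ler_pM2r q38); apply: le_trans (N2R_shiftr R _ 38) _; rewrite N2RM.
apply: (@le_trans _ _ (nn`!%:R / (nn.-1 ^ nn)%:R * 2 ^+ N.to_nat E *
    (2 ^+ 40 * growth R nn))).
  by apply: ler_pM; rewrite ?N2R_ge0 // growth_approx_le.
rewrite N2Nat.inj_add exprD (_ : 40 = 38 + N.to_nat 2)%N // [2 ^+ (_ + _)]exprD.
rewrite /growth factS natrM !natrX.
have := selections_neq0 R n2; rewrite natrX.
have : nn%:R ^+ nn.+1 != 0 :> R.
  by rewrite expf_neq0 // pnatr_eq0; case: (nn) n2.
move: (nn%:R ^+ _) (nn.-1%:R ^+ _) (2 ^+ 38) (2 ^+ N.to_nat 2) (2 ^+ N.to_nat E) => a b c d q a0 b0.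
move: nn.+1%:R nn`!%:R => x y.
suff -> : y / b * q * (c * d * (x * (b / a))) = x * y / a * (q * d) * c by [].
by field; rewrite a0 b0.
Qed.

Lemma table_entry_le (lo u fe : N) (g : R) (k : nat) :
  toR lo <= 2 ^+ 30 * g -> toR u * k`!%:R <= 2 ^+ N.to_nat fe -> 0 <= g ->
  toR (N.shiftr (lo * u) 48) * k`!%:R <= g * 2 ^+ N.to_nat (fe - 18).
Proof.
move=> loP uP g0.
have q48 : 0 < 2 ^+ 48 :> R by exact: exprn_gt0.
rewrite -(ler_pM2r q48) mulrAC.
apply: (@le_trans _ _ (toR lo * (toR u * k`!%:R))).
  by rewrite mulrA -N2RM ler_wpM2r //; exact: (N2R_shiftr R _ 48).
apply: (@le_trans _ _ (2 ^+ 30 * g * 2 ^+ N.to_nat fe)).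
  by apply: ler_pM; rewrite ?mulr_ge0 ?N2R_ge0.
rewrite [2 ^+ 30 * g]mulrC -[leLHS]mulrA -[leRHS]mulrA ler_wpM2l // -!exprD ler_weXn2l ?ler1n //; lia.
Qed.

Lemma next_fact_le (m E d : N) (n : N) :
  let nn := N.to_nat n in
  toR m * nn`!%:R <= 2 ^+ N.to_nat E ->
  toR (N.shiftr (N.shiftl m 11 / N.succ n) d) * nn.+1`!%:R <=
  2 ^+ N.to_nat (E + 11 - d).
Proof.
move=> nn mP.
have qd : 0 < 2 ^+ N.to_nat d :> R by exact: exprn_gt0.
rewrite -(ler_pM2r qd) mulrAC.
apply: (@le_trans _ _ (toR (N.shiftl m 11 / N.succ n) * nn.+1`!%:R)).
  by rewrite ler_wpM2r // N2R_shiftr.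
rewrite factS natrM mulrA.
apply: (@le_trans _ _ (toR (N.shiftl m 11) * nn`!%:R)).
  rewrite ler_wpM2r //; have := N2R_div R (N.shiftl m 11) (N.succ n).
  by rewrite [X in _ * X <= _]/N2R N2Nat.inj_succ.
rewrite N2R_shiftl mulrAC; apply: (@le_trans _ _ (2 ^+ N.to_nat E * 2 ^+ N.to_nat 11)).
  by rewrite ler_wpM2r ?pow2_ge0.
by rewrite -!exprD ler_weXn2l ?ler1n //; lia.
Qed.

Lemma advance_row_ok (s : state) (ext b : bool) : (2 <= N.to_nat (st_people s))%N ->
  row_ok R (N.to_nat (st_people s)) (N.to_nat (st_first s)) (st_row s) ->
  let p := advance_row ext b s in
  row_ok R (N.to_nat (st_people s)).+1 (N.to_nat p.1) p.2.
Proof.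
rewrite /advance_row => n2; case: (st_row s) => [|x r] //= [xP rP].
set n := N.to_nat (st_people s) in n2 xP rP *.
have r'P : row_ok R n.+1 (N.to_nat (st_first s)).+1
    (next_row ext (st_people s - st_first s)%num x r).
  by apply: next_row_ok; rewrite // N2Nat.inj_sub.
case: b => /=; last by rewrite N2Nat.inj_succ.
split=> //; case: N.eqb_spec => [->|first0].
  by have := source_le R (N.succ (st_people s)); rewrite N2Nat.inj_succ.
apply: (le_trans xP); rewrite ler_wpM2l ?pow2_ge0 // round_weight_mono //.
by lia.
Qed.

Lemma advance_norm_ok (s : state) :
  let n := N.to_nat (st_people s) in (2 <= n)%N ->
  toR (st_normm s) <= n`!%:R / (n.-1 ^ n)%:R * 2 ^+ N.to_nat (st_norme s) ->
  let n := N.to_nat (N.succ (st_people s)) in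
  toR (advance_norm s).1 <= n`!%:R / (n.-1 ^ n)%:R * 2 ^+ N.to_nat (advance_norm s).2.
Proof.
move=> n n2 normP; rewrite N2Nat.inj_succ /advance_norm.
set t := N.shiftr _ 38; set e := (_ + 2)%num.
have normP' : toR t <= n.+1`!%:R / (n ^ n.+1)%:R * 2 ^+ N.to_nat e by exact: next_norm_le.
case: ifP => // _.
have qe : 0 < 2 ^+ N.to_nat e :> R by exact: exprn_gt0.
rewrite -(ler_pM2r qe); apply: le_trans (N2R_shiftr_sub _ _ _ _) _.
by rewrite mulrAC ler_wpM2r ?pow2_ge0.
Qed.

Lemma sound_advance (g1 g2 : nat -> R) s : round_invariant g1 -> round_invariant g2 ->
  sound g1 g2 s -> sound g1 g2 (advance s).
Proof.
move=> h1 h2 [n2 rowP normP factP tab1 tab2 sizeT boundsP sizeB].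
rewrite /advance.
set n := N.succ _.
have nE : N.to_nat n = (N.to_nat (st_people s)).+1 by rewrite N2Nat.inj_succ.
have n'2 : (2 <= N.to_nat n)%N by rewrite nE ltnW.
have := advance_norm_ok n2 normP; rewrite -/n.
case: (advance_norm s) => t e normP'; rewrite [(t, e).1]/= [(t, e).2]/= in normP'.
set ext := (_ <? _)%num; set keep := (_ <=? _)%num.
have := @advance_row_ok s ext keep n2 rowP.
case: (advance_row ext keep s) => first' row' row'P.
set k0 := N.max _ _.
have k0E : N.to_nat k0 = (N.to_nat first' + N.to_nat (k0 - first'))%N by lia.
have := @dot_ok g1 g2 (e + 28)%num (N.to_nat n) (N.to_nat k0)
  (drop (N.to_nat (k0 - first')) row') (drop (N.to_nat k0) (st_table s)) 0%num 0%num
  (proj1 h1) (proj1 h2).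
rewrite {1}k0E nE; move=> /(_ (row_ok_drop _ row'P)).
move=> /(_ (table_ok_drop (k := 0) _ tab1) (table_ok_drop (k := 0) _ tab2)).
case: dot => T1 T2 [T1P T2P].
rewrite [toR 0]mulr0n mul0r add0r in T1P; rewrite [toR 0]mulr0n mul0r add0r in T2P.
rewrite -nE in T1P T2P.
have loP := bound_le h1 n'2 normP' T1P.
have coP := bound_le h2 n'2 normP' T2P.
set lo := N.shiftr (T1 * t) 42 in loP *; set co := N.shiftr (T2 * t) 42 in coP *.
set u0 := (N.shiftl _ 11 / n)%num.
have := @next_fact_le (st_factm s) (st_facte s) (N.size u0 - 40)%num (st_people s) factP.
rewrite -/n -/u0 -nE; set u := N.shiftr u0 _; set fe := (_ + 11 - _)%num => uP.
have tabP : (n < 600)%num -> (0 + size (st_table s) = N.to_nat n)%N.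
  by move=> n600; rewrite sizeT ?nE //; exact: N.lt_trans (N.lt_succ_diag_r _) n600.
split=> //; cbn [st_people st_first st_row st_table st_bounds].
- by rewrite nE.
- case: N.ltb_spec => // n600; apply: table_ok_rcons => //.
  by rewrite tabP //; exact: table_entry_le (proj1 h1 _).
- case: N.ltb_spec => // n600; apply: table_ok_rcons => //.
  by rewrite tabP //; exact: table_entry_le (proj1 h2 _).
- move=> n600; case: N.ltb_spec => [_|n600']; last first.
    by case: (N.lt_irrefl n); exact: N.lt_le_trans n600 n600'.
  by rewrite size_cat addn1 -(tabP n600).
- by split=> //; rewrite sizeB -nE.
- by rewrite nE -sizeB.
Qed.

Lemma sound_start (g1 g2 : nat -> R) : round_invariant g1 -> round_invariant g2 ->
  g1 0%N = 1 -> g2 1%N = 1 -> g1 2 = 1 -> sound g1 g2 start.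
Proof.
move=> [g1_ge0 _] [g2_ge0 _] g10 g21 g12.
have pow k : toR (2 ^ k)%num = 2 ^+ N.to_nat k by rewrite N2RX.
have one (g : nat -> R) n (k : N) : g n = 1 -> toR (2 ^ k)%num <= 2 ^+ N.to_nat k * g n.
  by move=> ->; rewrite pow mulr1.
have zero (g : nat -> R) n (c : R) : 0 <= c -> 0 <= g n -> toR 0 <= c * g n :> R.
  by move=> c0 gn; rewrite mulr_ge0.
have k1 (g : R) k : 1 <= g -> toR (2 ^ k)%num * 1 <= g * 2 ^+ N.to_nat k.
  by move=> g1_ge1; rewrite pow mulr1 ler_peMl ?pow2_ge0.
have k0 (g : R) k f : 0 <= g -> toR 0 * f <= g * 2 ^+ N.to_nat k.
  by move=> g0; rewrite [toR 0]mulr0n mul0r mulr_ge0 ?pow2_ge0.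
have half (g : R) k f : g = 1 -> f = 2 -> N.to_nat k = (N.to_nat (N.pred k)).+1 ->
    toR (2 ^ N.pred k)%num * f <= g * 2 ^+ N.to_nat k.
  by move=> -> -> ->; rewrite pow mul1r exprS mulrC.
apply: Sound; cbn [st_people st_first st_row st_table st_bounds
  st_normm st_norme st_factm st_facte].
- by [].
- split; [exact: (source_le R 2)|exact: I].
- rewrite -[N.to_nat _]/2%N -[st_normm _]/(2 ^ 40)%num -[st_norme _]/39%num pow.
  rewrite (_ : (2.-1 ^ 2)%N = 1%N) // divr1 -[N.to_nat 40]/(N.to_nat 39).+1 exprS.
  exact: lexx.
- rewrite -[N.to_nat (st_people _)]/2%N -[st_factm _]/(2 ^ 39)%num -[st_facte _]/40%num pow.
  rewrite -[N.to_nat 40]/(N.to_nat 39).+1 exprSr.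
  exact: lexx.
- split; first by apply: k1; rewrite g10.
  split; first exact: k0.
  by split; [apply: (half _ 24%num)|exact: I].
- split; first exact: k0.
  split; first by apply: k1; rewrite g21.
  by split; [exact: k0|exact: I].
- by [].
- split; [exact (one g1 2%N 30%num g12)|by apply: (zero g2); rewrite ?pow2_ge0|].
  split; [by apply: (zero g1); rewrite ?pow2_ge0|exact (one g2 1%N 30%num g21)|].
  split; [exact (one g1 0%N 30%num g10)|by apply: (zero g2); rewrite ?pow2_ge0|exact: I].
- by [].
Qed.

End StateSoundness.

(** * From the computed bounds to all numbers of people *)

Section Certificates.
Variable R : realType.
Local Notation toR := (N2R R).

(** A phase asserts [f <= u + K / A + K * test_fun a], with [u] and [K] given by
    their numerators [ph_u] and [ph_v] over [10 ^ 5], for all [a] in the window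
    [[A, B]].  As [test_fun a n + 1 / a] is [quad n.+1 a] below, it suffices that
    [f n <= u + K * quad n.+1 a]. *)
Record phase := Phase { ph_u : N; ph_v : N; ph_A : N; ph_B : N }.

(** [y] is a lower bound of [1 - f s.-1] in units of [2 ^ (- 30)].  The point [b]
    of the window that is closest to [s] minimizes [quad s]. *)
Definition below_at (c : phase) (s y : N) : bool :=
  let b := N.max (ph_A c) (N.min s (ph_B c)) in
  let d := ((s - b) + (b - s))%num in
  ((2 ^ 30 - y) * (10 ^ 5 * (s * b)) <=?
     2 ^ 30 * (ph_u c * (s * b) + ph_v c * (d * d)))%num.

Fixpoint below (sel : N * N -> N) (c : phase) (s : N) (l : seq (N * N)) : bool :=
  if l is x :: l' then below_at c s (sel x) && below sel c (N.pred s) l' else true.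

(** The list [l] covers the numbers of people below [m].  From [m] on the bound
    of the phase [prev] takes over; it is compared with the new bound at [m],
    where the latter is smallest.  The condition with [7 * 10 ^ 5] is the one
    that deals with fewer than [14] people in [dominated_step]. *)
Definition phase_ok (sel : N * N -> N) (m : N) (l : seq (N * N)) (prev c : phase) :=
  let s := N.succ m in
  let d := (s - ph_B c)%num in
  [&& (14 <=? ph_A c)%num, (ph_A c <=? ph_B c)%num, (ph_B c <=? s)%num,
      (1 <=? ph_A prev)%num,
      (7 * 10 ^ 5 <=? 7 * ph_u c + ph_v c * (ph_A c - 14))%num,
      ((ph_u prev * ph_A prev + ph_v prev) * (s * ph_B c) <=?
        ph_A prev * (ph_u c * (s * ph_B c) + ph_v c * (d * d)))%num &
      below sel c m l].

(** The length of the window uses [e <= 2.74]. *)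
Definition window_ok sel m l prev c :=
  phase_ok sel m l prev c && (274 * ph_A c <=? 100 * ph_B c)%num.

Definition phase_bound (c : phase) : R :=
  (toR (ph_u c) + toR (ph_v c) / toR (ph_A c)) / 10 ^+ 5.

Variable f : nat -> R.

Definition quad (s a : R) : R := (s - a) ^+ 2 / (s * a).

(** [quad s a = s / a + a / s - 2] decreases in [a] up to [s] and increases
    afterwards. *)
Lemma quad_clamp (s a A B : R) : 0 < s -> 0 < A -> A <= a <= B ->
  quad s (Num.max A (Num.min s B)) <= quad s a.
Proof.
move=> s0 A0 /andP[Aa aB].
have a0 : 0 < a by apply: lt_le_trans Aa.
have B0 : 0 < B by apply: lt_le_trans aB.
have diff x y : 0 < x -> 0 < y ->
    quad s x - quad s y = (x - y) * (x * y - s ^+ 2) / (s * x * y).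
  by move=> x0 y0; rewrite /quad; field; rewrite !gt_eqF.
have cmp x : 0 < x -> (x - a) * (x * a - s ^+ 2) <= 0 -> quad s x <= quad s a.
  move=> x0 le0; rewrite -subr_le0 diff // mulr_le0_ge0 //.
  by rewrite invr_ge0 !mulr_ge0 // ltW.
have [sB|Bs] := leP s B.
  have [As|sA] := leP A s.
    apply: cmp => //.
    have -> : (s - a) * (s * a - s ^+ 2) = - (s * (s - a) ^+ 2) by ring.
    by rewrite oppr_le0 mulr_ge0 ?sqr_ge0 // ltW.
  apply: cmp => //; rewrite mulr_le0_ge0 ?subr_le0 // subr_ge0 expr2.
  by rewrite ler_pM ?(ltW s0) ?(ltW sA) // (le_trans (ltW sA)).
have [AB|BA] := leP A B; last by lra.
apply: cmp => //; rewrite mulr_ge0_le0 ?subr_ge0 // subr_le0 expr2.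
by rewrite ler_pM ?(ltW B0) ?(ltW a0) ?(ltW Bs) // (le_trans aB) // ltW.
Qed.

Lemma N2R_minmax A s B :
  toR (N.max A (N.min s B)) = Num.max (toR A) (Num.min (toR s) (toR B)).
Proof.
have minE x y : toR (N.min x y) = Num.min (toR x) (toR y).
  case: (N.le_ge_cases x y) => xy; have := N2R_le R xy.
    by rewrite N.min_l // => h; rewrite min_l.
  by rewrite N.min_r // => h; rewrite min_r.
rewrite -minE; move: (N.min _ _) => y.
case: (N.le_ge_cases A y) => xy; have := N2R_le R xy.
  by rewrite N.max_r // => h; rewrite max_r.
by rewrite N.max_l // => h; rewrite max_l.
Qed.

Lemma N2R_dist x y : toR ((x - y) + (y - x)) = `|toR x - toR y|.
Proof.
case: (N.le_ge_cases x y) => xy.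
  rewrite (_ : ((x - y) + (y - x) = y - x)%num); last by lia.
  rewrite distrC ger0_norm ?subr_ge0 ?N2R_le //.
  exact: N2R_subE.
rewrite (_ : ((x - y) + (y - x) = x - y)%num); last by lia.
rewrite ger0_norm ?subr_ge0 ?N2R_le //.
exact: N2R_subE.
Qed.

Lemma below_at_ok c s y (a g : R) :
  (1 <= ph_A c)%num -> (1 <= s)%num -> toR (ph_A c) <= a <= toR (ph_B c) ->
  toR y <= 2 ^+ 30 * (1 - g) -> below_at c s y ->
  g <= toR (ph_u c) / 10 ^+ 5 + toR (ph_v c) / 10 ^+ 5 * quad (toR s) a.
Proof.
move=> A1 s1 aAB yP.
have pos z : (1 <= z)%num -> 0 < toR z by move=> z1; rewrite ltr0n; lia.
have := quad_clamp (pos _ s1) (pos _ A1) aAB; rewrite -N2R_minmax.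
rewrite /below_at; set b := N.max _ _ => le_quad.
have b0 : 0 < toR b by rewrite N2R_minmax lt_max (pos _ A1).
move=> /(N2R_leb R); rewrite N2RM N2RM N2RM N2RM N2RD N2RM N2RM N2RM N2RM.
rewrite !N2RX N2R_dist -expr2 real_normK ?num_real // => le1.
have := N2R_sub R (2 ^ 30)%num y; rewrite N2RX => le2.
have {le2}le2 : 2 ^+ 30 * g <= toR (2 ^ 30 - y)%num.
  apply: le_trans le2; move: yP; rewrite -[N.to_nat 30]/30%N.
  by move: (2 ^+ 30) => p; lra.
have sb0 : 0 < toR s * toR b by rewrite mulr_gt0 ?(pos _ s1).
suff : g <= toR (ph_u c) / 10 ^+ 5 + toR (ph_v c) / 10 ^+ 5 * quad (toR s) (toR b).
  move=> /le_trans; apply; rewrite lerD2l ler_wpM2l //.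
  by rewrite divr_ge0 ?N2R_ge0 ?exprn_ge0.
have q0 : 0 < 10 ^+ 5 :> R by exact: exprn_gt0.
have p0 : 0 < 2 ^+ 30 :> R by exact: exprn_gt0.
move: le1; rewrite -[N.to_nat 30]/30%N -[N.to_nat 5]/5%N /quad.
move: le2 sb0 q0 p0; move: (2 ^+ 30) (10 ^+ 5) (toR (_ - y)%num) => p q z le2 sb0 q0 p0 le1.
have {le1 le2}le1 : g * (q * (toR s * toR b)) <=
    toR (ph_u c) * (toR s * toR b) + toR (ph_v c) * (toR s - toR b) ^+ 2.
  rewrite -(ler_pM2l p0) [p * (g * _)]mulrA; apply: le_trans le1.
  by rewrite ler_wpM2r // ltW // mulr_gt0.
have qsb : 0 < q * (toR s * toR b) by rewrite mulr_gt0.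
rewrite -(ler_pM2r qsb); apply: (le_trans le1).
rewrite le_eqVlt; apply/orP; left; apply/eqP.
have : toR s != 0 by rewrite gt_eqF ?(pos _ s1).
by move: (toR s) (toR b) b0 q0 => x y' y0 q0 x0; field; rewrite x0 !gt_eqF.
Qed.

Lemma below_ok (sel : N * N -> N) c s l (a : R) :
  (1 <= ph_A c)%num -> toR (ph_A c) <= a <= toR (ph_B c) ->
  N.to_nat s = size l ->
  (forall n, (n < size l)%N ->
    toR (sel (nth (0%num, 0%num) l (size l - n.+1))) <= 2 ^+ 30 * (1 - f n)) ->
  below sel c s l ->
  forall n, (n < size l)%N ->
    f n <= toR (ph_u c) / 10 ^+ 5 + toR (ph_v c) / 10 ^+ 5 * quad n.+1%:R a.
Proof.
move=> A1 aAB; elim: l s => [|x l IHl] s //= sE selP /andP[chk belowP] n.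
rewrite ltnS leq_eqVlt => /predU1P[->|nl]; last first.
  apply: (IHl (N.pred s)) => //.
    by rewrite N2Nat.inj_pred sE.
  move=> i il; have := selP i (ltnW il); rewrite subSS.
  by rewrite -(subnSK il).
have := selP (size l) (ltnSn _); rewrite subnn => xP.
have -> : (size l).+1%:R = toR s by rewrite /N2R sE.
by apply: below_at_ok A1 _ aAB xP chk; lia.
Qed.

End Certificates.

Section Phases.
Variable R : realType.
Local Notation toR := (N2R R).
Variables (f : nat -> R) (sel : N * N -> N) (m : N) (l : seq (N * N)).
Hypothesis f_le1 : forall n, f n <= 1.
Hypothesis f_rec :
  forall n, (2 <= n)%N -> f n = \sum_(k < n.+1) round_law R n k * f k.
Hypothesis size_l : N.to_nat m = size l.
Hypothesis sel_ok : forall n, (n < size l)%N ->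
  toR (sel (nth (0%num, 0%num) l (size l - n.+1))) <= 2 ^+ 30 * (1 - f n).

Lemma phase_dominated prev c (a : R) :
  (forall n, (size l <= n)%N -> f n <= phase_bound R prev) ->
  phase_ok sel m l prev c -> toR (ph_A c) <= a <= toR (ph_B c) ->
  dominated f (phase_bound R c) (toR (ph_v c) / 10 ^+ 5) a.
Proof.
move=> prevP /and5P[/N.leb_le A14 /N.leb_le AB /N.leb_le Bs /N.leb_le Ap].
move=> /and3P[_ tailP belowP] aAB n.
have posN z : (1 <= z)%num -> 0 < toR z by move=> z1; rewrite ltr0n; lia.
have A0 : 0 < toR (ph_A c) by apply: posN; lia.
have a0 : 0 < a by case/andP: aAB => Aa _; apply: lt_le_trans Aa.
have q0 : 0 < 10 ^+ 5 :> R by exact: exprn_gt0.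
have v0 : 0 <= toR (ph_v c) / 10 ^+ 5 by rewrite divr_ge0 ?N2R_ge0 ?(ltW q0).
suff le_quad : f n <= toR (ph_u c) / 10 ^+ 5 + toR (ph_v c) / 10 ^+ 5 * quad n.+1%:R a.
  apply: (le_trans le_quad); rewrite test_funE // -/(quad _ a) /phase_bound mulrBr.
  rewrite mulrDl -!addrA lerD2l addrCA lerDl mulrAC -mulrBr mulr_ge0 // subr_ge0.
  by rewrite lef_pV2 ?posrE //; case/andP: aAB.
have [nl|ln] := ltnP n (size l).
  by apply: below_ok belowP _ nl => //; lia.
apply: (le_trans (prevP n ln)).
have B0 : 0 < toR (ph_B c) by apply: posN; lia.
have Ap0 : 0 < toR (ph_A prev) by apply: posN.
have s0 : 0 < toR (N.succ m) by apply: posN; lia.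
have sBn : toR (ph_B c) <= toR (N.succ m) <= n.+1%:R.
  by rewrite N2R_le //= ler_nat N2Nat.inj_succ size_l ltnS.
have le_quad : quad (toR (N.succ m)) (toR (ph_B c)) <= quad n.+1%:R a.
  have [/andP[_ aB] /andP[Bs' sn]] := (aAB, sBn).
  have n0 : 0 < n.+1%:R :> R by [].
  have symq x y : quad x y = quad y x :> R.
    by rewrite /quad -[(x - y) ^+ 2]sqrrN opprB [x * y]mulrC.
  apply: (@le_trans _ _ (quad n.+1%:R (toR (ph_B c)))).
    rewrite !(symq _ (toR (ph_B c))).
    have := @quad_clamp R _ n.+1%:R (toR (N.succ m)) n.+1%:R B0 s0.
    by rewrite sn lexx (min_l (le_trans Bs' sn)) (max_l Bs'); apply.
  have := quad_clamp n0 A0 aAB.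
  by rewrite (min_r (le_trans Bs' sn)) max_r // N2R_le.
apply: (@le_trans _ _ (toR (ph_u c) / 10 ^+ 5 + toR (ph_v c) / 10 ^+ 5 *
   quad (toR (N.succ m)) (toR (ph_B c)))); last by rewrite lerD2l ler_wpM2l.
move: tailP => /(N2R_leb R); rewrite N2RM N2RD N2RM N2RM N2RM N2RD N2RM N2RM N2RM N2RM.
rewrite N2R_subE //.
rewrite /phase_bound /quad; move: q0; move: (10 ^+ 5) => q q0 {posN sBn v0 aAB}.
move: (toR (N.succ m)) s0 (toR (ph_B c)) B0 (toR (ph_A prev)) Ap0 => s s0 B B0 A' A'0 tailP.
have sB0 : 0 < A' * (s * B) by rewrite !mulr_gt0.
rewrite -(ler_pM2r q0) -(ler_pM2r sB0).
move: tailP; set lhs := (X in X <= _ -> _); set rhs := (X in _ <= X -> _) => tailP.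
suff [-> ->] : (toR (ph_u prev) + toR (ph_v prev) / A') / q * q * (A' * (s * B)) = lhs /\
  (toR (ph_u c) / q + toR (ph_v c) / q * ((s - B) ^+ 2 / (s * B))) * q * (A' * (s * B)) = rhs by [].
by split; rewrite /lhs /rhs; field; rewrite !gt_eqF.
Qed.

Lemma phase_small c prev : phase_ok sel m l prev c ->
  1 <= phase_bound R c + toR (ph_v c) / 10 ^+ 5 * (toR (ph_A c) / 7 - 2).
Proof.
case/and5P => /N.leb_le A14 _ _ _ /and3P[/(N2R_leb R)].
rewrite N2RM N2RD N2RM N2RM N2RX -[N.to_nat 5]/5%N => small _ _.
have A14' : toR (ph_A c - 14)%num = toR (ph_A c) - 14 by exact: N2R_subE.
have A0 : 0 < toR (ph_A c) by rewrite ltr0n; lia.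
have q0 : 0 < 10 ^+ 5 :> R by exact: exprn_gt0.
rewrite A14' -[toR 7]/(7%:R) in small.
have vA : 0 <= toR (ph_v c) / toR (ph_A c) by rewrite divr_ge0 ?N2R_ge0.
rewrite /phase_bound; move: small q0; move: (10 ^+ 5) => q small q0.
rewrite -(ler_pM2r q0) mulrDl divfK ?gt_eqF // mul1r.
rewrite [_ / q * _]mulrAC divfK ?gt_eqF //.
by move: (toR (ph_u c)) (toR (ph_v c)) (toR (ph_A c)) (_ / _) vA small => u v A w; lra.
Qed.

Lemma phase_window prev c :
  (forall n, (size l <= n)%N -> f n <= phase_bound R prev) ->
  window_ok sel m l prev c ->
  forall n, (size l <= n)%N -> f n <= phase_bound R c.
Proof.
move=> prevP /andP[ok /(N2R_leb R)]; rewrite !N2RM => AB n ln.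
have ok' := ok; case/and5P: ok' => /N.leb_le A14 /N.leb_le AB' /N.leb_le Bs _ _.
have q0 : 0 < 10 ^+ 5 :> R by exact: exprn_gt0.
apply: (dominated_window f_le1 f_rec _ _ (phase_small ok)
  (B := toR (ph_B c)) _ (fun a => phase_dominated prevP ok)).
- by rewrite divr_ge0 ?N2R_ge0 ?(ltW q0).
- by rewrite ltr0n; lia.
- have := e_le R; have : 0 <= toR (ph_A c) by exact: N2R_ge0.
  move: AB; rewrite -[toR 274]/(274%:R) -[toR 100]/(100%:R); nra.
- apply: (@le_trans _ _ (toR (N.succ m))); last by rewrite ler_nat N2Nat.inj_succ size_l ltnS.
  by apply: N2R_le; lia.
Qed.

Lemma phase_infinitely prev c :
  (forall n, (size l <= n)%N -> f n <= phase_bound R prev) ->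
  phase_ok sel m l prev c ->
  forall n0, exists2 n, (n0 <= n)%N & f n <= phase_bound R c.
Proof.
move=> prevP ok.
have ok' := ok; case/and5P: ok' => /N.leb_le A14 /N.leb_le AB /N.leb_le Bs _ _.
have q0 : 0 < 10 ^+ 5 :> R by exact: exprn_gt0.
apply: (dominated_infinitely f_le1 f_rec _ _ (phase_small ok)).
- by rewrite divr_ge0 ?N2R_ge0 ?(ltW q0).
- by rewrite ltr0n; lia.
- by apply: (phase_dominated prevP ok); rewrite lexx N2R_le.
Qed.

Lemma phase_chain cs c :
  (forall n, (size l <= n)%N -> f n <= phase_bound R c) ->
  path (window_ok sel m l) c cs ->
  forall n, (size l <= n)%N -> f n <= phase_bound R (seq.last c cs).
Proof.
elim: cs c => [|c' cs IHcs] c cP //= /andP[ok okcs].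
by apply: IHcs okcs; exact: phase_window ok.
Qed.

End Phases.

(** * Upper and lower limits *)

Section UpperLowerLimits.
Variable R : realType.
Local Open Scope ereal_scope.
Implicit Types (u : nat -> \bar R) (x : \bar R).

Lemma limn_esup_ub u x N : (forall n, (N <= n)%N -> u n <= x) -> limn_esup u <= x.
Proof.
move=> ux; rewrite limn_esup_lim; apply: lime_le; first exact: is_cvg_esups.
exists N => // n /= Nn; apply: ge_ereal_sup => _ [k /= nk <-].
by apply: ux; exact: leq_trans nk.
Qed.

Lemma limn_esup_lb u x :
  (forall N, exists2 n, (N <= n)%N & x <= u n) -> x <= limn_esup u.
Proof.
move=> xu; rewrite limn_esup_lim; apply: lime_ge; first exact: is_cvg_esups.
apply: nearW => N; have [n Nn xn] := xu N.
by apply: (le_trans xn); apply: ereal_sup_ubound; exists n.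
Qed.

Lemma limn_einf_lb u x N : (forall n, (N <= n)%N -> x <= u n) -> x <= limn_einf u.
Proof.
move=> xu; rewrite limn_einf_lim; apply: lime_ge; first exact: is_cvg_einfs.
exists N => // n /= Nn; apply: le_ereal_inf_tmp => _ [k /= nk <-].
by apply: xu; exact: leq_trans nk.
Qed.

Lemma limn_einf_ub u x :
  (forall N, exists2 n, (N <= n)%N & u n <= x) -> limn_einf u <= x.
Proof.
move=> ux; rewrite limn_einf_lim; apply: lime_le; first exact: is_cvg_einfs.
apply: nearW => N; have [n Nn nx] := ux N.
by apply: (le_trans _ nx); apply: ereal_inf_lbound; exists n.
Qed.

End UpperLowerLimits.

Section StrictLimits.
Variable R : realType.
Implicit Types (g : nat -> R) (c : R).

Definition eventually_at_most (g : nat -> R) (c : R) :=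
  exists2 M, M < c & exists N, forall n, (N <= n)%N -> g n <= M.

Definition infinitely_at_most (g : nat -> R) (c : R) :=
  exists2 M, M < c & forall N, exists2 n, (N <= n)%N & g n <= M.

Lemma limn_esup_lt g c : eventually_at_most g c ->
  (limn_esup (fun n => (g n)%:E) < c%:E)%E.
Proof.
move=> [M Mc [N gM]]; apply: (@le_lt_trans _ _ M%:E); last by rewrite lte_fin.
by apply: (limn_esup_ub (N := N)) => n /gM; rewrite lee_fin.
Qed.

Lemma limn_einf_lt g c : infinitely_at_most g c ->
  (limn_einf (fun n => (g n)%:E) < c%:E)%E.
Proof.
move=> [M Mc gM]; apply: (@le_lt_trans _ _ M%:E); last by rewrite lte_fin.
by apply: limn_einf_ub => N; have [n Nn gn] := gM N; exists n.
Qed.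

Lemma limn_einf_gt g c : eventually_at_most (fun n => 1 - g n) (1 - c) ->
  (c%:E < limn_einf (fun n => (g n)%:E))%E.
Proof.
move=> [M Mc [N gM]]; apply: (@lt_le_trans _ _ (1 - M)%:E); first by rewrite lte_fin; lra.
by apply: (limn_einf_lb (N := N)) => n /gM; rewrite lee_fin; lra.
Qed.

Lemma limn_esup_gt g c : infinitely_at_most (fun n => 1 - g n) (1 - c) ->
  (c%:E < limn_esup (fun n => (g n)%:E))%E.
Proof.
move=> [M Mc gM]; apply: (@lt_le_trans _ _ (1 - M)%:E); first by rewrite lte_fin; lra.
apply: limn_esup_lb => N; have [n Nn gn] := gM N; exists n => //.
by rewrite lee_fin; lra.
Qed.

Lemma complement_fraction (a b d : nat) : (a + b = d)%N -> (0 < d)%N ->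
  1 - a%:R / d%:R = b%:R / d%:R :> R.
Proof.
move=> abd d0; apply/eqP; rewrite subr_eq -mulrDl -natrD addnC abd divff //.
by rewrite pnatr_eq0 -lt0n.
Qed.

Lemma not_cvg_of_gap g :
  (limn_einf (fun n => (g n)%:E) < limn_esup (fun n => (g n)%:E))%E -> ~ cvgn g.
Proof.
move=> gap /cvg_ex[l gl].
have glE : ((g n)%:E @[n --> \oo] --> l%:E)%classic.
  by apply: cvg_EFin => //; exact: nearW.
have [infE supE] := cvg_limn_einf_sup glE.
by rewrite infE supE ltxx in gap.
Qed.

End StrictLimits.

(** * Numerical certificate *)

(** Its bound is [1]. *)
Definition trivial_phase : phase := Phase (10 ^ 5) 0 1 1.

(** The successive bounds for [p] are about [0.52680], [0.52397], [0.52372] and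
    [0.52368]. *)
Definition death_phases : seq phase :=
  [:: Phase 52402 50000 180 494; Phase 52372 10000 404 1107;
      Phase 52365 3000 428 1173; Phase 52365 1500 446 1223].

(** The successive bounds for [1 - p] are about [0.53230] and [0.52973]. *)
Definition survival_phases : seq phase :=
  [:: Phase 53030 20000 100 274; Phase 52968 1500 314 861].

(** The centres are close to a local minimum and a local maximum of [p]
    respectively, where a single test function gives the best bounds. *)
Definition death_dip : phase := Phase 47046 55000 626 626.
Definition survival_dip : phase := Phase 47641 85000 1024 1024.

Definition final_state : state := iter 1316 advance start.

Definition phase_lt (c : phase) (x : N) : bool :=
  ((ph_u c * ph_A c + ph_v c) * 10 ^ 4 <? x * (10 ^ 5 * ph_A c))%num.

Definition certificate (s : state) : bool :=
  let l := st_bounds s in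
  let m := N.succ (st_people s) in
  let death := seq.last trivial_phase death_phases in
  let survival := seq.last trivial_phase survival_phases in
  [&& path (window_ok snd m l) trivial_phase death_phases,
      path (window_ok fst m l) trivial_phase survival_phases,
      phase_ok snd m l death death_dip,
      phase_ok fst m l survival survival_dip,
      phase_lt death 5237, phase_lt survival 5298,
      phase_lt death_dip 4714 & phase_lt survival_dip 4773].

Lemma certified : certificate final_state = true.
Proof. by vm_cast_no_check (erefl true). Qed.

Section Conclusion.
Variable R : realType.
Local Notation p := (no_survivor_prob R).
Local Notation q := (fun n => 1 - p n).

Lemma round_invariant_no_survivor : round_invariant p.
Proof.
split=> n; first by case/andP: (no_survivor_bounds R n).
exact: no_survivor_rec.
Qed.

Lemma round_invariant_survivor : round_invariant q.
Proof.
split=> n; first by rewrite subr_ge0; case/andP: (no_survivor_bounds R n).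
move=> n2; rewrite no_survivor_rec // -[in LHS](sum_round_law R n2) -sumrB.
by apply: eq_bigr => k _; rewrite mulrBr mulr1.
Qed.

Lemma sound_iter k : sound p q (iter k advance start).
Proof.
elim: k => [|k IHk]; last first.
  exact: sound_advance round_invariant_no_survivor round_invariant_survivor IHk.
apply: sound_start; first exact: round_invariant_no_survivor.
- exact: round_invariant_survivor.
- by rewrite no_survivor_small.
- by rewrite no_survivor_small // subr0.
- exact: no_survivor2.
Qed.

Lemma nth_bounds_ok (g1 g2 : nat -> R) l n : bounds_ok g1 g2 l -> (n < size l)%N ->
  let x := nth (0%num, 0%num) l (size l - n.+1) in
  N2R R x.1 <= 2 ^+ 30 * g1 n /\ N2R R x.2 <= 2 ^+ 30 * g2 n.
Proof.
elim: l => [|x l IHl] //= [xP1 xP2 lP]; rewrite ltnS leq_eqVlt => /predU1P[->|nl].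
  by rewrite subnn.
by rewrite subSS -(subnSK nl); exact: IHl.
Qed.

Lemma phase_lt_ok c x : (1 <= ph_A c)%num -> phase_lt c x ->
  phase_bound R c < N2R R x / 10 ^+ 4.
Proof.
move=> A1 /N.ltb_lt lt.
have : N2R R ((ph_u c * ph_A c + ph_v c) * 10 ^ 4) < N2R R (x * (10 ^ 5 * ph_A c)).
  by rewrite ltr_nat; lia.
rewrite !N2RM N2RD N2RM !N2RX -[N.to_nat 4]/4%N -[N.to_nat 5]/5%N /phase_bound.
have A0 : 0 < N2R R (ph_A c) by rewrite ltr0n; lia.
have p0 : 0 < 10 ^+ 4 :> R by exact: exprn_gt0.
have q0 : 0 < 10 ^+ 5 :> R by exact: exprn_gt0.
move: (10 ^+ 4) (10 ^+ 5) p0 q0 => a b a0 b0 {}lt.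
rewrite ltr_pdivlMr // mulrAC ltr_pdivrMr // -(ltr_pM2r A0) -mulrA.
suff -> : (N2R R (ph_u c) + N2R R (ph_v c) / N2R R (ph_A c)) * (a * N2R R (ph_A c)) =
  (N2R R (ph_u c) * N2R R (ph_A c) + N2R R (ph_v c)) * a by rewrite -mulrA.
by field; rewrite gt_eqF.
Qed.

Lemma certificate_bounds s : sound p q s -> certificate s ->
  [/\ eventually_at_most p (5237 / 10 ^+ 4), eventually_at_most q (5298 / 10 ^+ 4),
      infinitely_at_most p (4714 / 10 ^+ 4) & infinitely_at_most q (4773 / 10 ^+ 4)].
Proof.
move=> [_ _ _ _ _ _ _ boundsP sizeB]; rewrite /certificate.
have size_m : N.to_nat (N.succ (st_people s)) = size (st_bounds s).
  by rewrite sizeB N2Nat.inj_succ.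
move: (st_bounds s) (N.succ _) size_m boundsP => l m size_m boundsP {sizeB}.
case/and5P => pathP pathQ dipP dipQ /and4P[lt1 lt2 lt3 lt4].
have p1 n : p n <= 1 by case/andP: (no_survivor_bounds R n).
have q1 n : q n <= 1 by rewrite gerBl; case/andP: (no_survivor_bounds R n).
have [_ p_rec] := round_invariant_no_survivor; have [_ q_rec] := round_invariant_survivor.
have selP n : (n < size l)%N ->
    N2R R (snd (nth (0%num, 0%num) l (size l - n.+1))) <= 2 ^+ 30 * (1 - p n).
  by move=> nl; case: (nth_bounds_ok boundsP nl).
have selQ n : (n < size l)%N ->
    N2R R (fst (nth (0%num, 0%num) l (size l - n.+1))) <= 2 ^+ 30 * (1 - q n).
  by move=> nl; rewrite opprB addrCA subrr addr0; case: (nth_bounds_ok boundsP nl).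
have triv : phase_bound R trivial_phase = 1.
  rewrite /phase_bound [N2R R (ph_v _)]mulr0n mul0r addr0 -[ph_u _]/(10 ^ 5)%num N2RX.
  by rewrite -[N2R R 10]/(10%:R) -[N.to_nat 5]/5%N divff // expf_neq0 // pnatr_eq0.
have startP (g : nat -> R) : (forall n, g n <= 1) -> forall n, (size l <= n)%N ->
    g n <= phase_bound R trivial_phase by move=> g1 n _; rewrite triv.
have boundP := phase_chain p1 p_rec size_m selP (startP _ p1) pathP.
have boundQ := phase_chain q1 q_rec size_m selQ (startP _ q1) pathQ.
have infP := phase_infinitely p1 p_rec size_m selP boundP dipP.
have infQ := phase_infinitely q1 q_rec size_m selQ boundQ dipQ.
have ltP c x : (1 <= ph_A c)%num -> phase_lt c x -> phase_bound R c < N2R R x / 10 ^+ 4.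
  exact: phase_lt_ok.
split.
- exists (phase_bound R (seq.last trivial_phase death_phases)).
    exact: (ltP _ 5237%num).
  by exists (size l).
- exists (phase_bound R (seq.last trivial_phase survival_phases)).
    exact: (ltP _ 5298%num).
  by exists (size l).
- by exists (phase_bound R death_dip) => //; exact: (ltP _ 4714%num).
- by exists (phase_bound R survival_dip) => //; exact: (ltP _ 4773%num).
Qed.

End Conclusion.

Theorem theorem2 (R : realType) :
  ~ cvgn (no_survivor_prob R) /\
  ((4702 / 10 ^+ 4)%:E < limn_einf (fun n => (no_survivor_prob R n)%:E)
     < (4714 / 10 ^+ 4)%:E)%E /\
  ((5227 / 10 ^+ 4)%:E < limn_esup (fun n => (no_survivor_prob R n)%:E)
     < (5237 / 10 ^+ 4)%:E)%E.
Proof.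
have [supP infQ infP supQ] :=
  certificate_bounds (sound_iter R 1316 : sound _ _ final_state) certified.
have compl (a b : nat) : (a + b = 10 ^ 4)%N -> 1 - a%:R / 10 ^+ 4 = b%:R / 10 ^+ 4 :> R.
  by move=> ab; rewrite -natrX; exact: complement_fraction.
have inf_gt : ((4702 / 10 ^+ 4)%:E < limn_einf (fun n => (no_survivor_prob R n)%:E))%E.
  by apply: limn_einf_gt; rewrite (compl 4702 5298).
have sup_gt : ((5227 / 10 ^+ 4)%:E < limn_esup (fun n => (no_survivor_prob R n)%:E))%E.
  by apply: limn_esup_gt; rewrite (compl 5227 4773).
have inf_lt := limn_einf_lt infP; have sup_lt := limn_esup_lt supP.
split; last by split; apply/andP; [exact: conj inf_gt inf_lt|exact: conj sup_gt sup_lt].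
apply: not_cvg_of_gap; apply: (lt_trans inf_lt); apply: (le_lt_trans _ sup_gt).
by rewrite lee_fin ler_pM2r ?ler_nat // invr_gt0 exprn_gt0.
Qed.
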